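(* Let $q\ge 3$ be an integer such that the group $\mathbb{Z}_q^*$ is cyclic. Then $$c(q,1)=\zeta(\varphi(q))\,\Pi(q,1)\prod_{p\mid q}\Bigl(1-\frac1{p^{\varphi(q)}}\Bigr)\prod_{p\equiv1\bmod q}\Bigl(1-\frac1{p^{\varphi(q)}}\Bigr)\times\prod_{\substack{n\mid\varphi(q)\\ 1<n<\varphi(q)}}\ \prod_{\substack{p\nmid q\\ t_p=n}}\Bigl\{\Bigl(1-\frac1{p^n}\Bigr)^{-\varphi(q)/n}\Bigl(1-\frac1{p^{\varphi(q)}}\Bigr)\Bigr\},$$ where $t_p$ denotes the order of $p$ in the multiplicative group $\mathbb{Z}_q^*$ (for $p\nmid q$) and $$\Pi(q,1)=\prod_{\substack{\chi \bmod q\\ \chi\neq\chi_0}}L(1,\chi)^{-1}.$$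
   Context: Throughout, $p$ denotes a prime number, $\varphi$ is the Euler totient function, $\zeta$ is the Riemann zeta function, $\gamma$ is Euler's constant, $\mathbb{Z}_q^*$ is the group of reduced residue classes modulo $q$, $\chi$ ranges over Dirichlet characters modulo $q$, $\chi_0$ is the principal character modulo $q$, and $L(s,\chi)$ is the Dirichlet $L$-function of $\chi$. For $(q,a)=1$, the Mertens constant is $$C(q,a)=\lim_{x\to+\infty}(\log x)^{1/\varphi(q)}\prod_{\substack{p\le x\\ p\equiv a \bmod q}}\Bigl(1-\frac1p\Bigr),$$ a positive real number. The constant $c(q,a)$ is defined by $$C(q,a)^{\varphi(q)}=e^{-\gamma}\,\frac{q}{\varphi(q)}\,c(q,a);$$ equivalently (it is known that) $$c(q,a)=\prod_{p\nmid q}\Bigl(1-\frac1p\Bigr)^{\alpha(p;q,a)}=\lim_{x\to+\infty}\prod_{\substack{p\le x\\ p\nmid q}}\Bigl(1-\frac1p\Bigr)^{\alpha(p;q,a)},$$ where $\alpha(p;q,a)=\varphi(q)-1$ if $p\equiv a\bmod q$ and $\alpha(p;q,a)=-1$ otherwise; this product converges (conditionally) when taken over primes in increasing order. *)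

(* Defs.v *)
From HB Require Import structures.
From mathcomp Require Import all_boot all_order all_algebra all_fingroup all_solvable.
From mathcomp Require Import all_classical all_reals all_analysis.
From mathcomp Require Export complex.
Set Implicit Arguments.
Unset Strict Implicit.
Unset Printing Implicit Defensive.
Import Order.TTheory GRing.Theory Num.Theory.
Import numFieldNormedType.Exports.
Local Open Scope classical_set_scope.
Local Open Scope complex_scope.
Local Open Scope ring_scope.

Definition euler_gamma (R : realType) : R :=
  limn (fun n => \sum_(1 <= k < n.+1) (k%:R : R)^-1 - ln n%:R).

(* The Dirichlet series, hence the zeta function only on the half-line 1 < s. *)
Definition zeta (R : realType) (s : R) : R :=
  limn (series (fun n => n.+1%:R `^ (- s))).

(* C(q,a); meaningful when a is coprime to q. *)
Definition mertens_const (R : realType) (q a : nat) : R :=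
  lim ((fun x : R => ln x `^ ((totient q)%:R)^-1 *
     \prod_(0 <= p < (Num.truncn x).+1 | prime p && (p == a %[mod q]))
       (1 - (p%:R)^-1)) @ +oo).

(* c(q,a), obtained by solving
   C(q,a) ^ phi(q) = e ^ (- gamma) * (q / phi(q)) * c(q,a). *)
Definition mertens_c (R : realType) (q a : nat) : R :=
  mertens_const R q a ^+ totient q /
  (expR (- euler_gamma R) * (q%:R / (totient q)%:R)).

(* Infinite product over the primes satisfying P, taken in increasing order. *)
Definition prime_prod (R : realType) (P : pred nat) (F : nat -> R) : R :=
  limn (fun N => \prod_(0 <= p < N | prime p && P p) F p).

(* Multiplicativity together with chi 1 = 1 forces chi to be nonzero on units.
   'Z_q is the ring of residues modulo q only for 1 < q. *)
Definition dirichlet_character (R : realType) (q : nat)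
    (chi : {ffun 'Z_q -> R[i]}) : Prop :=
  [/\ chi 1 = 1,
      forall x y, chi (x * y) = chi x * chi y
    & forall x, x \isn't a GRing.unit -> chi x = 0].

Definition principal_character (R : realType) (q : nat) : {ffun 'Z_q -> R[i]} :=
  [ffun x => if x \is a GRing.unit then 1 else 0].

(* Sum of the Dirichlet series at a real s; for chi non-principal it converges
   (conditionally) for 0 < s, in particular at s = 1. The alias ^o carries the
   topology of R[i] given by the complex modulus. *)
Definition dirichletL (R : realType) (q : nat) (s : R)
    (chi : {ffun 'Z_q -> R[i]}) : R[i] :=
  limn (fun N => \sum_(1 <= n < N) chi n%:R * (n%:R `^ (- s))%:C : (R[i])^o).

(* Pi(q,1): the big operator ranges over a classical set, and is the usual
   product because there are finitely many characters modulo q. *)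
Definition Pi_q1 (R : realType) (q : nat) : R[i] :=
  \big[*%R/1]_(chi \in [set chi : {ffun 'Z_q -> R[i]} |
      dirichlet_character chi /\ chi != principal_character R q])
    (dirichletL 1 chi)^-1.

(* t_p: order of the class of p in the unit group of 'Z_q, for p coprime to q
   (for other p the class is not a unit and the default value 1 is used). *)
Definition unit_order (q p : nat) : nat :=
  #[insubd (1%g : {unit 'Z_q}) (p%:R : 'Z_q)]%g.

(* Main.v *)
Require Import Defs.
From HB Require Import structures.
From mathcomp Require Import all_boot all_order all_algebra all_fingroup all_solvable.
From mathcomp Require Import separable cyclotomic.
From mathcomp Require Import all_classical all_reals all_analysis.
From mathcomp Require Import ring lra zify.
Set Implicit Arguments.
Unset Strict Implicit.
Unset Printing Implicit Defensive.
Import Order.TTheory GRing.Theory Num.Theory.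
Import numFieldNormedType.Exports.
Local Open Scope classical_set_scope.
Local Open Scope complex_scope.
Local Open Scope ring_scope.

(**
For a prime p not dividing q, of order n modulo q, the product of 1 - chi(p) z
over all characters chi is (1 - z^n)^(phi(q)/n). Multiplying the Euler products
over all characters thus gives, for s > 1, the real number
  D(s) = zeta(s) prod_(p | q) (1 - p^-s) prod_(chi != chi0) L(s, chi)
       = prod_(p not dividing q) (1 - p^(-n s))^(-phi(q)/n).
As D >= 1, at most one L(1, chi) vanishes, so only a real chi could be
exceptional; it is excluded by Monsky's argument with the Lambert series
sum chi(n) x^n / (1 - x^n). Hence D(1 + d) d tends, as d decreases to 0, to a
positive limit l, namely phi(q)/q times the product of the L(1, chi), and
  sum_(p = 1 mod q) phi(q) p^(-1-d) = - ln d + ln l - rho + o(1),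
where rho is the value at s = 1 of the uniformly convergent remainder of
ln D(s). A Tauberian theorem of Karamata type, which compares the masses
phi(q)/p at ln p with the masses 1/n at n, turns this into
  sum_(p <= x, p = 1 mod q) phi(q)/p = ln ln x + ln l - rho + gamma + o(1).
The harmonic masses have Laplace transform - ln (1 - e^-d), and this is where
Euler's constant enters. The primes of order phi(q) are absorbed by the Euler
product of zeta(phi(q)).
*)

(** * A Tauberian theorem *)

(** Both measures accumulate mass only like ln T, and the constant is wanted up to an additive o(1).
    Approximating a step by polynomials with a uniform error [th] would cost [th] times a mass that
    diverges as d decreases to 0. The admissible error is therefore th (u - u^2), which vanishes at
    both ends of [0,1]: with u = exp(-d t) it integrates to th (A(d) - A(2d)), and this difference
    stays bounded. Comparing two measures, instead of evaluating one, reduces the analysis to A1 -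
    A2, whose limit is insensitive to rescaling d, and lets the constant of the second measure be
    read off the harmonic sums. Only real s >= 1 occurs; complex numbers enter through the values of
    the characters alone. That the product over all characters is a real number at least 1 comes
    from its Euler product, whose factors are real and lie in (0,1]. Cyclicity makes the characters
    explicit: a generator goes to the powers of a root of unity of order phi(q). *)

Lemma telescope_sumrB (V : zmodType) m n (f : nat -> V) : (m <= n)%N ->
  \sum_(m <= i < n) (f i - f i.+1) = f m - f n.
Proof.
move=> mn; under eq_bigr do rewrite -opprB.
by rewrite sumrN telescope_sumr// opprB.
Qed.

Lemma subr1_expn_ge (R : realFieldType) (z : R) n : 0 <= z <= 1 -> 1 - n%:R * z <= (1 - z) ^+ n.
Proof.
move=> /andP[z0 z1]; elim: n => [|n IH]; first by rewrite mul0r subr0 expr0.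
rewrite exprS.
have h : (1 - z) * (1 - n%:R * z) <= (1 - z) * (1 - z) ^+ n.
  by rewrite ler_wpM2l// subr_ge0.
apply: le_trans h; rewrite -natr1.
have : 0 <= n%:R * z * z by rewrite !mulr_ge0.
nra.
Qed.

Lemma addr1_expn_ge (R : realFieldType) (z : R) n : 0 <= z -> 1 + n%:R * z <= (1 + z) ^+ n.
Proof.
move=> z0; elim: n => [|n IH]; first by rewrite mul0r addr0 expr0.
rewrite exprS.
have h : (1 + z) * (1 + n%:R * z) <= (1 + z) * (1 + z) ^+ n.
  by rewrite ler_wpM2l// addr_ge0.
apply: le_trans h; rewrite -natr1.
have : 0 <= n%:R * z * z by rewrite !mulr_ge0.
nra.
Qed.

(* The witness 1 - (1 - X^N)^(2^N) jumps from 0 to 1 near 1/2, since (2u)^N is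
   tiny for u < 1/2 and huge for u > 1/2. *)
Lemma step_polynomial (R : realType) (b b' th : R) :
  0 < b < 2^-1 -> 2^-1 < b' < 1 -> 0 < th ->
  exists p : {poly R}, [/\ p.[0] = 0, p.[1] = 1 &
    forall u, 0 <= u <= 1 ->
      p.[u] <= (b <= u)%R%:R + th * (u - u ^+ 2) /\
      (b' <= u)%R%:R - th * (u - u ^+ 2) <= p.[u]].
Proof.
move=> /andP[b0 b2] /andP[b'2 b'1] th0.
pose h := 2 * b' - 1.
have h0 : 0 < h by rewrite /h; lra.
(* Below [b] the allowance th (u - u^2) is at least th u / 2, above [b'] at least th (1 - u) / 2;
   [h] is the Bernoulli slope in (2 b')^k >= h k. This fixes the constants 4 and 8 / h. *)
have [k [k0 k1 k2]] : exists k : nat,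
    [/\ (0 < k)%N, 4 * (2 * b) ^+ k <= th & 8 / h * ((2 * b')^-1) ^+ k <= th].
  have c1 : (fun k : nat => (2 * b) ^+ k) @ \oo --> 0.
    by apply: cvg_expr; rewrite ger0_norm; lra.
  have c2 : (fun k : nat => ((2 * b')^-1) ^+ k) @ \oo --> 0.
    apply: cvg_expr; rewrite ger0_norm ?invr_ge0; last by lra.
    by rewrite invf_lt1; lra.
  have t4 : 0 < th / 4 by rewrite divr_gt0.
  have t8 : 0 < th / (8 / h) by rewrite !divr_gt0.
  move/cvgrPdist_le : c1 => /(_ _ t4) c1.
  move/cvgrPdist_le : c2 => /(_ _ t8) c2.
  near \oo => k; exists k; split.
  - by near: k; exists 1%N.
  - have : `|0 - (2 * b) ^+ k| <= th / 4 by near: k; exact: c1.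
    have b20 : 0 <= 2 * b by lra.
    by rewrite sub0r normrN ger0_norm ?exprn_ge0// => ?; lra.
  - have : `|0 - ((2 * b')^-1) ^+ k| <= th / (8 / h) by near: k; exact: c2.
    rewrite sub0r normrN ger0_norm; last first.
      by rewrite exprn_ge0// invr_ge0; lra.
    by rewrite ler_pdivlMr ?divr_gt0// mulrC.
(* M = 2^N gives M u^N = (2 u)^N. With N = 2 k, (2 b')^N is a product of two k-th powers: one
   outweighs the factor N of 1 - u^N <= N (1 - u), the other yields [th]. *)
pose N := k.*2; pose M := (2 ^ N)%N.
have N0 : (0 < N)%N by rewrite /N double_gt0.
have M1 : (2 <= M)%N by rewrite /M -{1}(expn1 2) leq_exp2l.
exists (1 - (1 - 'X^N) ^+ M); split.
- by rewrite !hornerE/= expr0n gtn_eqF// subr0 expr1n subrr.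
- by rewrite !hornerE/= expr1n subrr expr0n gtn_eqF ?subr0// (leq_trans _ M1).
move=> u /andP[u0 u1]; rewrite !hornerE /=.
set z := u ^+ N.
have z01 : 0 <= z <= 1 by rewrite exprn_ge0//= exprn_ile1.
have /andP[z0 z1] := z01.
have uu : 0 <= u - u ^+ 2 by rewrite expr2; nra.
have P0 : 0 <= (1 - z) ^+ M by rewrite exprn_ge0// subr_ge0.
have P1 : (1 - z) ^+ M <= 1 by rewrite exprn_ile1// ?subr_ge0// lerBlDr lerDl.
have tu : 0 <= th * (u - u ^+ 2) by rewrite mulr_ge0// ltW.
split.
  case: (leP b u) => bu /=; first by rewrite -[leLHS]addr0 mulr1n; lra.
  rewrite add0r.
  have := subr1_expn_ge M z01.
  have -> : M%:R * z = (2 * u) ^+ N by rewrite /M natrX exprMn.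
  have u2 : (2 * u) ^+ N <= 2 * u * (2 * b) ^+ k.
    have -> : N = (1 + (k + k.-1))%N by rewrite /N -addnn addnCA add1n prednK.
    rewrite exprD expr1 ler_wpM2l ?mulr_ge0//.
    apply: le_trans (_ : (2 * u) ^+ k <= _).
      have u20 : 0 <= 2 * u by lra.
      have u21 : 2 * u <= 1 by lra.
      by rewrite exprD ler_piMr ?exprn_ge0// exprn_ile1.
    by rewrite lerXn2r// ?nnegrE; lra.
  have : 0 <= u * (th - 4 * (2 * b) ^+ k) by rewrite mulr_ge0// subr_ge0.
  have u2' : 0 <= 1 - 2 * u by lra.
  have : 0 <= u * (1 - 2 * u) * th by rewrite mulr_ge0 ?(ltW th0)// mulr_ge0.
  rewrite expr2; lra.
case: (leP b' u) => bu /=; last by rewrite mulr0n; lra.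
rewrite mulr1n lerD2l lerN2.
have -> : M = (1 + M.-1)%N by rewrite add1n prednK// (leq_trans _ M1).
rewrite exprD expr1.
have e1 : 1 - z <= N%:R * (1 - u).
  have := @subr1_expn_ge R (1 - u) N; rewrite subKr => /(_ _).
  by rewrite -/z => H; rewrite lerBlDr -lerBlDl H// subr_ge0 u1 lerBlDr lerDl.
have up : 0 < u by lra.
(* Here (2 b')^N <= M z <= 2 (1 + z)^(M-1), and (1 - z) (1 + z) <= 1. *)
have e2 : (1 - z) ^+ M.-1 * (2 * b') ^+ N <= 2.
  have bb : (2 * b') ^+ N <= M%:R * z.
    by rewrite /M natrX -exprMn lerXn2r// ?nnegrE; lra.
  have Mz : M%:R * z <= 2 * (1 + z) ^+ M.-1.
    apply: le_trans (_ : 2 * (1 + M.-1%:R * z) <= _); last first.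
      by rewrite ler_wpM2l// addr1_expn_ge.
    have : (M%:R : R) = M.-1%:R + 1 by rewrite natr1 prednK// (leq_trans _ M1).
    have : 0 <= M.-1%:R * z by rewrite mulr_ge0.
    by move=> ? ->; lra.
  apply: le_trans (_ : (1 - z) ^+ M.-1 * (2 * (1 + z) ^+ M.-1) <= _).
    by rewrite ler_wpM2l ?(le_trans bb)// exprn_ge0 ?subr_ge0.
  have zz : (1 - z) * (1 + z) = 1 - z ^+ 2 by ring.
  have /andP[zz0 zz1] : 0 <= z ^+ 2 <= 1 by rewrite exprn_ge0//= exprn_ile1.
  by rewrite mulrCA -exprMn zz ler_piMr// exprn_ile1 ?subr_ge0// lerBlDr lerDl.
have bk : h * k%:R <= (2 * b') ^+ k.
  have := @addr1_expn_ge R h k (ltW h0).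
  by rewrite {2}/h addrCA subrr addr0 mulrC; lra.
have bN : (2 * b') ^+ N = (2 * b') ^+ k * (2 * b') ^+ k by rewrite /N -addnn exprD.
have bk0 : 0 < (2 * b') ^+ k by rewrite exprn_gt0//; lra.
move: k2; rewrite exprVn -ler_pdivlMr ?invr_gt0// invrK ler_pdivrMr// => k2.
have x0 : 0 <= (1 - z) ^+ M.-1 by rewrite exprn_ge0 ?subr_ge0.
move: e2; rewrite bN; set X := (1 - z) ^+ M.-1 => e2.
set B := (2 * b') ^+ k in bk k2 bk0 e2 *.
have XkB : X * (h * k%:R) * B <= 2.
  by apply: le_trans e2; rewrite [leRHS]mulrA ler_wpM2r ?(ltW bk0)// ler_wpM2l.
have kX : 4 * k%:R * X <= th.
  rewrite -(ler_pM2r (_ : 0 < h * B)); last by rewrite mulr_gt0.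
  have : 4 * (X * (h * k%:R) * B) <= 8 by lra.
  have -> : 4 * k%:R * X * (h * B) = 4 * (X * (h * k%:R) * B) by ring.
  have -> : th * (h * B) = th * B * h by ring.
  lra.
apply: le_trans (_ : N%:R * (1 - u) * X <= _); first by rewrite ler_wpM2r.
have -> : (N%:R : R) = 2 * k%:R by rewrite /N -muln2 natrM mulrC.
have -> : u - u ^+ 2 = u * (1 - u) by ring.
have : 0 <= (1 - u) * (th - 4 * k%:R * X) by rewrite mulr_ge0 ?subr_ge0.
have : 0 <= (1 - u) * (u - 2^-1) * th.
  by rewrite !mulr_ge0 ?subr_ge0// ?(ltW th0)// (le_trans _ bu)// ltW.
lra.
Unshelve. all: by end_near.
Qed.

(* A discrete measure is given by masses a n placed at the points lam n. *)
Definition laplace (R : realType) (a lam : nat -> R) (A : R -> R) :=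
  forall d, 0 < d ->
    (fun N => \sum_(0 <= n < N) a n * expR (- (d * lam n))) @ \oo --> A d.

Definition mass_upto (R : realType) (a lam : nat -> R) (m : R -> R) :=
  forall T, (fun N => \sum_(0 <= n < N) a n * (lam n <= T)%R%:R) @ \oo --> m T.

(** The integral of p(exp(-d t)) against the measure with Laplace transform [A]: the monomial X^k
    contributes A(k d). The term k = 0 involves the meaningless [A 0] and disappears when [p.[0] =
    0]. *)
Definition laplace_poly (R : realType) (A : R -> R) (p : {poly R}) (d : R) :=
  \sum_(k < size p) p`_k * A (k%:R * d).

Lemma laplace_polyP (R : realType) (a lam : nat -> R) A (p : {poly R}) d :
  laplace a lam A -> 0 < d -> p.[0] = 0 ->
  (fun N => \sum_(0 <= n < N) a n * p.[expR (- (d * lam n))]) @ \oo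
    --> laplace_poly A p d.
Proof.
move=> hA d0 p0; rewrite /laplace_poly.
under eq_fun => N.
  under eq_bigr => n _ do rewrite horner_coef mulr_sumr.
  rewrite exchange_big /=; over.
apply: (cvg_big add_continuous) => k _.
case: (posnP k) => k0.
  rewrite k0 -horner_coef0 p0 mul0r.
  under eq_fun do (rewrite big1; last by move=> *; rewrite mul0r mulr0).
  exact: cvg_cst.
under eq_fun => N.
  under eq_bigr => n _ do rewrite mulrCA -expRM_natl mulrN [_%:R * _]mulrA.
  rewrite -mulr_sumr; over.
by apply: cvgMl_tmp; apply: hA; rewrite mulr_gt0// ltr0n.
Qed.

(** This is the integral of the error term u - u^2 of [step_polynomial]. *)
Lemma laplace_poly_gap (R : realType) (a lam : nat -> R) A d :
  laplace a lam A -> 0 < d ->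
  (fun N => \sum_(0 <= n < N) a n * (expR (- (d * lam n)) - expR (- (d * lam n)) ^+ 2))
    @ \oo --> A d - A (2 * d).
Proof.
move=> hA d0; under eq_fun => N.
  under eq_bigr => n _ do rewrite mulrBr -expRM_natl mulrN [2 * _]mulrA.
  rewrite sumrB; over.
by apply: cvgB; apply: hA => //; rewrite mulr_gt0.
Qed.

(** For u = exp(-d t), the condition b <= u reads t <= - ln b / d, so integrating the bound on [p]
    turns its step into the mass function. *)
Lemma laplace_poly_upper (R : realType) (a lam : nat -> R) A m (p : {poly R}) b th d :
  (forall n, 0 <= a n) -> (forall n, 0 <= lam n) ->
  laplace a lam A -> mass_upto a lam m -> 0 < d -> p.[0] = 0 -> 0 < b ->
  (forall u, 0 <= u <= 1 -> p.[u] <= (b <= u)%R%:R + th * (u - u ^+ 2)) ->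
  laplace_poly A p d <= m (- ln b / d) + th * (A d - A (2 * d)).
Proof.
move=> a0 l0 hA hm d0 p0 b0 hp.
have h1 := laplace_polyP hA d0 p0.
have h2 := cvgD (hm (- ln b / d)) (@cvgMl_tmp _ _ _ _ _ th _ (laplace_poly_gap hA d0)).
apply: (ler_cvg_to h1 (h2 _ _)); near=> N; rewrite !fctE.
rewrite [in leRHS]mulr_sumr -big_split /=; apply: ler_sum => n _.
rewrite mulrCA -mulrDr ler_wpM2l//.
apply: le_trans (hp _ _) _; first by rewrite expR_ge0 expR_le1 oppr_le0 mulr_ge0// ltW.
rewrite lerD2r -(@ler_ln _ b)//= ?posrE ?expR_gt0// expRK.
by rewrite ler_pdivlMr// lerNr mulrC.
Unshelve. all: by end_near.
Qed.

Lemma laplace_poly_lower (R : realType) (a lam : nat -> R) A m (p : {poly R}) b th d :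
  (forall n, 0 <= a n) -> (forall n, 0 <= lam n) ->
  laplace a lam A -> mass_upto a lam m -> 0 < d -> p.[0] = 0 -> 0 < b ->
  (forall u, 0 <= u <= 1 -> (b <= u)%R%:R - th * (u - u ^+ 2) <= p.[u]) ->
  m (- ln b / d) - th * (A d - A (2 * d)) <= laplace_poly A p d.
Proof.
move=> a0 l0 hA hm d0 p0 b0 hp.
have h1 := laplace_polyP hA d0 p0.
have h2 := cvgB (hm (- ln b / d)) (@cvgMl_tmp _ _ _ _ _ th _ (laplace_poly_gap hA d0)).
apply: (ler_cvg_to (h2 _ _) h1); near=> N; rewrite !fctE.
rewrite [in leLHS]mulr_sumr -sumrB /=; apply: ler_sum => n _.
rewrite mulrCA -mulrBr ler_wpM2l//.
apply: le_trans (hp _ _); last by rewrite expR_ge0 expR_le1 oppr_le0 mulr_ge0// ltW.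
rewrite lerD2r -(@ler_ln _ b)//= ?posrE ?expR_gt0// expRK.
by rewrite ler_pdivlMr// lerNr mulrC.
Unshelve. all: by end_near.
Qed.

Lemma cvg_id_right0 (R : realType) : d @[d --> (0 : R)^'+] --> (0 : R).
Proof. by move=> A [e e0 eA]; exists e => // x xe _; exact: eA. Qed.

Lemma cvg_near0_scale (R : realType) (f : R -> R) (c k : R) : 0 < k ->
  f d @[d --> 0^'+] --> c -> f (k * d) @[d --> 0^'+] --> c.
Proof.
move=> k0 fc; apply: cvg_comp fc.
move=> A [e /= e0 eA]; exists (e / k); first by rewrite /= divr_gt0.
move=> d /= ; rewrite sub0r normrN => de d0; apply: eA => /=.
  by rewrite sub0r normrN normrM gtr0_norm// mulrC -ltr_pdivlMr.
by rewrite mulr_gt0.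
Qed.

Lemma cvg_inv_right0 (R : realType) (f : R -> R) (c k : R) : 0 < k ->
  f d @[d --> 0^'+] --> c -> f (k / T) @[T --> +oo] --> c.
Proof.
move=> k0 fc; apply: cvg_comp fc.
move=> A [e /= e0 eA]; exists (k / e); split; first exact: num_real.
move=> T kT; have T0 : 0 < T by rewrite (lt_trans _ kT)// divr_gt0.
apply: eA => /=; last by rewrite divr_gt0.
by rewrite sub0r normrN gtr0_norm ?divr_gt0// ltr_pdivrMr// mulrC -ltr_pdivrMr.
Qed.

(* Karamata's argument: testing against step_polynomial squeezes m1 between
   values of m2 at slightly dilated arguments. *)
Theorem karamata_compare (R : realType) (a1 a2 lam1 lam2 : nat -> R)
    (A1 A2 m1 m2 : R -> R) (c g C : R) :
  (forall n, 0 <= a1 n) -> (forall n, 0 <= lam1 n) ->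
  (forall n, 0 <= a2 n) -> (forall n, 0 <= lam2 n) ->
  laplace a1 lam1 A1 -> laplace a2 lam2 A2 ->
  mass_upto a1 lam1 m1 -> mass_upto a2 lam2 m2 ->
  (forall d, 0 < d -> A2 d - A2 (2 * d) <= C) ->
  A1 d - A2 d @[d --> 0^'+] --> c ->
  m2 T - ln T @[T --> +oo] --> g ->
  m1 T - ln T @[T --> +oo] --> c + g.
Proof.
move=> a10 l10 a20 l20 hA1 hA2 hm1 hm2 hC hc hg.
pose B := `|C| + 1.
have B0 : 0 < B by rewrite /B ltr_wpDl.
have gap2 d : 0 < d -> A2 d - A2 (2 * d) <= B.
  by move=> /hC; rewrite /B; have := ler_norm C; lra.
(* A1 - A2 has the same limit at d and at 2 d, so A1 inherits the bounded gap of A2. *)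
have gap1 : \forall d \near 0^'+, A1 d - A1 (2 * d) <= B.
  have /cvgrPdist_le : (A1 d - A2 d) - (A1 (2 * d) - A2 (2 * d)) @[d --> 0^'+] --> c - c.
    by apply: cvgB => //; exact: (@cvg_near0_scale _ (fun d => A1 d - A2 d)).
  move=> /(_ 1 ltr01); rewrite subrr => H; near=> d.
  have d0 : 0 < d by near: d; exact: nbhs_right_gt.
  have : `|0 - (A1 d - A2 d - (A1 (2 * d) - A2 (2 * d)))| <= 1 by near: d; exact: H.
  rewrite sub0r normrN ler_norml => /andP[_]; have := hC _ d0; have := ler_norm C.
  by rewrite /B; lra.
apply/cvgrPdist_le => e e0.
pose l2 : R := ln 2.
have l20' : 0 < l2 by rewrite /l2 ln_gt0// ltr1n.
(* The step is placed between exp(-k) < 1/2 < exp(-k'). At d = k / T the lower threshold corresponds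
   to the mass up to T exactly, the other one to the mass up to (k' / k) T; the roles are exchanged
   at d = k' / T. Since ln (k / k') = e / 4, the dilation costs e / 4, and each remaining error is
   at most e / 8. *)
pose k := l2 * expR (e / 8); pose k' := l2 * expR (- (e / 8)).
have k0 : 0 < k by rewrite mulr_gt0// expR_gt0.
have k'0 : 0 < k' by rewrite mulr_gt0// expR_gt0.
have e8 : 0 < e / 8 by rewrite divr_gt0.
have th0 : 0 < e / (8 * B) by rewrite divr_gt0// mulr_gt0.
have thB : e / (8 * B) * B = e / 8.
  by rewrite invfM mulrA -[LHS]mulrA mulVf ?mulr1// gt_eqF.
set th := e / (8 * B) in th0 thB.
have half : (2^-1 : R) = expR (- l2) by rewrite expRN /l2 lnK// posrE.
have [|||p [p0 p1 hp]] := @step_polynomial R (expR (- k)) (expR (- k')) th.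
- rewrite expR_gt0/= half ltr_expR ltrN2 /k ltr_pMr// -[ltLHS]expR0 ltr_expR//.
- rewrite half ltr_expR ltrN2 /k' expR_lt1 oppr_lt0 k'0 andbT.
  by rewrite gtr_pMr// expR_lt1 oppr_lt0.
- by [].
(* As [p.[1] = 1] the coefficients of [p] sum to 1, and every A1(i d) - A2(i d) with i > 0 tends to
   the same [c]. *)
have diff : laplace_poly A1 p d - laplace_poly A2 p d @[d --> 0^'+] --> c.
  have -> : c = \sum_(k < size p) p`_k * c.
    rewrite -mulr_suml -[LHS]mul1r -p1 horner_coef.
    by congr (_ * _); apply: eq_bigr => i _; rewrite expr1n mulr1.
  under eq_fun => d do rewrite /laplace_poly -sumrB.
  apply: (cvg_big add_continuous) => i _.
  under eq_fun => d do rewrite -mulrBr.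
  case: (posnP i) => i0.
    rewrite i0 -horner_coef0 p0 mul0r.
    under eq_fun do rewrite mul0r.
    exact: cvg_cst.
  apply: cvgMl_tmp; apply: (@cvg_near0_scale _ (fun d => A1 d - A2 d)) => //.
  by rewrite ltr0n.
have hd := fun k k0 => @cvg_inv_right0 _ _ _ k k0 diff.
have lnr (r : R) : 0 < r -> m2 (r * T) - ln T @[T --> +oo] --> g + ln r.
  move=> r0.
  have : m2 (r * T) - ln (r * T) + ln r @[T --> +oo] --> g + ln r.
    apply: cvgD; last exact: cvg_cst.
    apply: (@cvg_comp _ _ _ (fun T => r * T) (fun T => m2 T - ln T)) hg.
    move=> S [M [Mr MS]]; exists (M / r); split; first exact: num_real.
    by move=> x Mx; apply: MS; rewrite -ltr_pdivrMl// mulrC.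
  apply: cvg_trans; apply: near_eq_cvg; near=> T.
  have T0 : 0 < T by near: T; exact: nbhs_pinfty_gt.
  by rewrite lnM ?posrE//; lra.
have kk : ln (k / k') = e / 4.
  by rewrite ln_div ?posrE// !lnM ?posrE ?expR_gt0// !expRK; lra.
have kk' : ln (k' / k) = - (e / 4).
  by rewrite ln_div ?posrE// !lnM ?posrE ?expR_gt0// !expRK; lra.
have := lnr _ (divr_gt0 k0 k'0); rewrite kk => /cvgrPdist_le/(_ _ e8) N1.
have := lnr _ (divr_gt0 k'0 k0); rewrite kk' => /cvgrPdist_le/(_ _ e8) N2.
have := hd _ k0 => /cvgrPdist_le/(_ _ e8) N3.
have := hd _ k'0 => /cvgrPdist_le/(_ _ e8) N4.
have N56 r : 0 < r -> \forall T \near +oo, A1 (r / T) - A1 (2 * (r / T)) <= B.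
  move=> r0; case: gap1 => z /= z0 H; near=> T.
  have T0 : 0 < T by near: T; exact: nbhs_pinfty_gt.
  apply: H => /=; last by rewrite divr_gt0.
  rewrite sub0r normrN gtr0_norm ?divr_gt0// ltr_pdivrMr// mulrC -ltr_pdivrMr//.
  by near: T; apply: nbhs_pinfty_gt; exact: num_real.
near=> T.
have T0 : 0 < T by near: T; exact: nbhs_pinfty_gt.
have N1' : `|g + e / 4 - (m2 (k / k' * T) - ln T)| <= e / 8 by near: T; exact: N1.
have N2' : `|g - e / 4 - (m2 (k' / k * T) - ln T)| <= e / 8 by near: T; exact: N2.
have N3' : `|c - (laplace_poly A1 p (k / T) - laplace_poly A2 p (k / T))| <= e / 8.
  by near: T; exact: N3.
have N4' : `|c - (laplace_poly A1 p (k' / T) - laplace_poly A2 p (k' / T))| <= e / 8.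
  by near: T; exact: N4.
have N5 : A1 (k / T) - A1 (2 * (k / T)) <= B by near: T; exact: N56.
have N6 : A1 (k' / T) - A1 (2 * (k' / T)) <= B by near: T; exact: N56.
have kT : 0 < k / T by rewrite divr_gt0.
have k'T : 0 < k' / T by rewrite divr_gt0.
have dk x y : 0 < x -> y / (x / T) = y / x * T by move=> x0; rewrite invf_div mulrA mulrAC.
have up1 := laplace_poly_upper a10 l10 hA1 hm1 kT p0 (expR_gt0 _) (fun u hu => (hp u hu).1).
have lo2 := laplace_poly_lower a20 l20 hA2 hm2 kT p0 (expR_gt0 _) (fun u hu => (hp u hu).2).
have up2 := laplace_poly_upper a20 l20 hA2 hm2 k'T p0 (expR_gt0 _) (fun u hu => (hp u hu).1).
have lo1 := laplace_poly_lower a10 l10 hA1 hm1 k'T p0 (expR_gt0 _) (fun u hu => (hp u hu).2).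
move: up1 lo2 up2 lo1; rewrite !expRK !opprK !dk// !divff ?gt_eqF// !mul1r => up1 lo2 up2 lo1.
have t1 := ler_wpM2l (ltW th0) N5; have t2 := ler_wpM2l (ltW th0) N6.
have t3 := ler_wpM2l (ltW th0) (gap2 _ kT); have t4 := ler_wpM2l (ltW th0) (gap2 _ k'T).
rewrite thB in t1 t2 t3 t4.
move: N1' N2' N3' N4'; rewrite !ler_norml => /andP[? ?] /andP[? ?] /andP[? ?] /andP[? ?].
by apply/andP; split; lra.
Unshelve. all: by end_near.
Qed.

(** * The harmonic measure and Euler's constant *)

(** The remainder after the term of degree M has derivative y^M / (1 - y), and the mean value
    theorem on [0,x] bounds it by x^M / (1 - x). The term n = 0 is zero because the inverse of 0 is
    0. *)
Lemma log_series (R : realType) (x : R) : 0 < x < 1 ->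
  (fun N => \sum_(0 <= n < N) (n%:R)^-1 * x ^+ n) @ \oo --> - ln (1 - x).
Proof.
move=> /andP[x0 x1].
suff H M : `|- ln (1 - x) - \sum_(0 <= n < M.+1) (n%:R)^-1 * x ^+ n| <= (1 - x)^-1 * x ^+ M.
  rewrite -(@cvg_shiftS R); apply/cvgrPdist_le => e e0.
  have /cvgrPdist_le/(_ _ e0) c : (fun M => (1 - x)^-1 * x ^+ M) @ \oo --> 0.
    rewrite -[X in _ --> X](mulr0 (1 - x)^-1); apply: cvgMl_tmp.
    by apply: cvg_expr; rewrite gtr0_norm.
  near=> M; apply: le_trans (H M) _.
  apply: le_trans (ler_norm _) _; rewrite -normrN -sub0r.
  by near: M.
pose p : {poly R} := \poly_(n < M.+1) (n%:R)^-1.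
have pE y : p.[y] = \sum_(0 <= n < M.+1) (n%:R)^-1 * y ^+ n.
  by rewrite horner_poly big_mkord.
have dpE y : p^`().[y] = \sum_(i < M) y ^+ i.
  have -> : p^`() = \poly_(i < M) 1.
    apply/polyP => i; rewrite coef_deriv !coef_poly ltnS.
    case: ifP => _; last by rewrite mul0rn.
    by rewrite -[LHS]mulr_natr mulVf ?pnatr_eq0.
  by rewrite horner_poly; apply: eq_bigr => i _; rewrite mul1r.
have [||c] := @MVT_segment R (fun y => - ln (1 - y) - p.[y])
    (fun y => (1 - y)^-1 - p^`().[y]) 0 x (ltW x0).
- move=> y; rewrite in_itv /= => /andP[y0 yx].
  have y1 : 0 < 1 - y by rewrite subr_gt0 (lt_trans yx).
  have d1 : is_derive y 1 (fun y => 1 - y) (-1).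
    by apply: (is_derive_eq (is_deriveB (is_derive_cst (1 : R) y 1) (is_derive_id y 1))); rewrite sub0r.
  have d2 := @is_derive1_comp R (@ln R) (fun y => 1 - y) y _ _ (is_derive1_ln y1) d1.
  have d3 := is_deriveB (is_deriveN d2) (is_derive_poly p y).
  by apply: (is_derive_eq d3); rewrite mulrN1 opprK.
- apply: derivable_within_continuous => y; rewrite in_itv/= => /andP[y0 yx].
  have y1 : 0 < 1 - y by rewrite subr_gt0 (le_lt_trans yx).
  have d1 : is_derive y 1 (fun y => 1 - y) (-1).
    by apply: (is_derive_eq (is_deriveB (is_derive_cst (1 : R) y 1) (is_derive_id y 1))); rewrite sub0r.
  have d2 := @is_derive1_comp R (@ln R) (fun y => 1 - y) y _ _ (is_derive1_ln y1) d1.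
  by have [] := is_deriveB (is_deriveN d2) (is_derive_poly p y).
rewrite in_itv/= => /andP[c0 cx].
have c1 : 0 < 1 - c by rewrite subr_gt0 (le_lt_trans cx).
rewrite !subr0 ln1 oppr0 sub0r opprK -pE.
have -> : p.[0] = 0 by rewrite horner_coef0 coef_poly invr0.
rewrite addr0 => ->.
have -> : (1 - c)^-1 - p^`().[c] = c ^+ M / (1 - c).
  rewrite dpE; apply: (@mulIf _ (1 - c)); first by rewrite gt_eqF.
  rewrite mulrBl mulVf ?gt_eqF// divfK ?gt_eqF//.
  have := @subrXX R 1 c M; rewrite expr1n.
  under eq_bigr do rewrite expr1n mul1r.
  by rewrite mulrC => <-; rewrite subKr.
have cM : 0 <= c ^+ M by rewrite exprn_ge0.
rewrite ger0_norm; last by rewrite mulr_ge0 ?divr_ge0// ltW.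
apply: le_trans (_ : c ^+ M / (1 - c) <= _).
  by rewrite ler_piMr// ?divr_ge0// ltW.
have x1' : 0 < 1 - x by rewrite subr_gt0.
rewrite mulrC; apply: ler_pM; rewrite ?invr_ge0 ?(ltW c1)//.
  by rewrite lef_pV2 ?posrE// lerD2l lerN2.
by rewrite lerXn2r// nnegrE ltW.
Unshelve. all: by end_near.
Qed.

Lemma harmonic_laplace (R : realType) :
  laplace (fun n => n%:R^-1) (fun n => n%:R) (fun d : R => - ln (1 - expR (- d))).
Proof.
move=> d d0; have := @log_series R (expR (- d)).
rewrite expR_gt0 expR_lt1 oppr_lt0 => /(_ d0).
by under eq_fun do under eq_bigr do rewrite -expRM_natr mulNr.
Qed.

(** The left-hand side equals ln (1 + exp(-d)), by factoring 1 - exp(-2 d). *)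
Lemma harmonic_laplace_gap (R : realType) (d : R) : 0 < d ->
  - ln (1 - expR (- d)) - - ln (1 - expR (- (2 * d))) <= 1.
Proof.
move=> d0; have e1 : expR (- d) < 1 by rewrite expR_lt1 oppr_lt0.
have e0 := expR_gt0 (- d).
have -> : 1 - expR (- (2 * d)) = (1 - expR (- d)) * (1 + expR (- d)).
  by rewrite -mulrN expRM_natl; ring.
rewrite lnM ?posrE ?subr_gt0 ?addr_gt0// opprK addKr.
by apply: le_trans (le_ln1Dx _) (ltW e1); rewrite (lt_trans _ e0)// ltrN10.
Qed.

(** Indices without mass are exempt from the condition, so that the conventional position of the
    index 0 does not matter. *)
Lemma mass_upto_cut (R : realType) (a lam : nat -> R) T K :
  (forall n, a n != 0 -> (lam n <= T) = (n < K)%N) ->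
  (fun N => \sum_(0 <= n < N) a n * (lam n <= T)%R%:R) @ \oo -->
    \sum_(0 <= n < K) a n.
Proof.
move=> H; apply: cvg_near_cst; near=> N.
have KN : (K <= N)%N by near: N; exact: nbhs_infty_ge.
rewrite (@big_cat_nat _ _ _ K)//= [X in _ + X]big1_seq ?addr0; last first.
  move=> i /andP[_]; rewrite mem_index_iota => /andP[iK _].
  have [->|/H ->] := eqVneq (a i) 0; first by rewrite mul0r.
  by rewrite ltnNge iK mulr0.
apply: eq_big_nat => i /andP[_ iK].
have [->|/H ->] := eqVneq (a i) 0; first by rewrite mul0r.
by rewrite iK mulr1.
Unshelve. all: by end_near.
Qed.

Lemma harmonic_mass (R : realType) :
  mass_upto (fun n => n%:R^-1) (fun n => n%:R)
    (fun T : R => \sum_(0 <= k < (Num.truncn T).+1) (k%:R)^-1).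
Proof.
move=> T; apply: mass_upto_cut => -[|n]; first by rewrite invr0 eqxx.
by move=> _; rewrite ltnS truncn_gt_nat.
Qed.

(** A [limn] carries information only once convergence is known; here the sequence decreases and is
    bounded below by 0. *)
Lemma euler_gamma_cvg (R : realType) :
  (fun n => \sum_(1 <= k < n.+1) (k%:R : R)^-1 - ln n%:R) @ \oo --> euler_gamma R.
Proof.
pose u n : R := \sum_(1 <= k < n.+1) (k%:R : R)^-1 - ln n%:R.
have lnS n : ln (n.+2%:R : R) - ln n.+1%:R = - ln (1 - n.+2%:R^-1).
  have -> : 1 - n.+2%:R^-1 = n.+1%:R / n.+2%:R :> R.
    have x0 : (n.+2%:R : R) != 0 by rewrite pnatr_eq0.
    by apply: (mulIf x0); rewrite mulrBl divfK// mulVf// mul1r -natr1 addrK.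
  by rewrite ln_div ?posrE// opprB.
(* The shift is needed: with ln 0 = 0 one has u 0 = 0 < 1 = u 1, so the sequence decreases only from
   index 1 on. *)
suff: cvgn (fun n => u n.+1) by move/cvg_ex => [l /=]; rewrite (@cvg_shiftS R u) => ul; apply/cvg_ex; exists l.
apply: (@nonincreasing_is_cvgn R).
  apply/nonincreasing_seqP => n; rewrite /u big_nat_recr//= -subr_ge0.
  set S := \sum_(_ <= _ < _) _.
  have -> : S - ln n.+1%:R - (S + n.+2%:R^-1 - ln n.+2%:R) =
    ln (n.+2%:R : R) - ln n.+1%:R - n.+2%:R^-1 by ring.
  rewrite lnS subr_ge0 lerNr; apply: le_ln1Dx.
  by rewrite ltrN2 invf_lt1// ltr1n.
exists 0 => _ [n _ <-]; rewrite /u subr_ge0.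
suff H : ln (n.+1%:R : R) <= \sum_(1 <= k < n.+1) (k%:R)^-1.
  by rewrite big_nat_recr//= (le_trans H)// lerDl invr_ge0.
elim: n => [|n IH]; first by rewrite ln1 big_geq.
rewrite big_nat_recr//= -lerBlDr; apply: le_trans IH.
rewrite lerBlDr -lerBlDl -ln_div ?posrE//.
have x0 : (n.+1%:R : R) != 0 by rewrite pnatr_eq0.
have -> : n.+2%:R / n.+1%:R = 1 + n.+1%:R^-1 :> R.
  by rewrite -natr1 mulrDl divff// mul1r.
by apply: le_ln1Dx; rewrite (@lt_le_trans _ _ 0)// ?invr_ge0// ltrN10.
Qed.

Lemma harmonic_mass_asymp (R : realType) :
  \sum_(0 <= k < (Num.truncn T).+1) (k%:R : R)^-1 - ln T @[T --> +oo] --> euler_gamma R.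
Proof.
have c := @euler_gamma_cvg R.
have t : Num.truncn (T : R) @[T --> +oo] --> \oo.
  move=> A [N _ NA]; exists N%:R; split; first exact: num_real.
  by move=> x Nx; apply: NA => /=; rewrite truncn_ge_nat ?ltW// (le_lt_trans _ Nx).
have c1 := cvg_comp _ _ t c.
have c3 : - (2 / T) @[T --> +oo] --> (0 : R).
  have [|_ +] := @gtr0_cvgV0 R R (pinfty_nbhs R) _ id; first exact: nbhs_pinfty_gt.
  move=> /(_ (@cvg_id _ _)) c3.
  by have := cvgN (@cvgMl_tmp _ _ _ _ _ 2 _ c3); rewrite mulr0 oppr0; apply.
have b : \forall T \near +oo, - (2 / T) <= ln (Num.truncn T)%:R - ln (T : R) <= 0.
  near=> T.
  have T2 : 2 < T by near: T; apply: nbhs_pinfty_gt; exact: num_real.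
  have T0 : 0 < T by rewrite (lt_trans _ T2).
  have /andP[t1 t2] := truncn_itv (ltW T0).
  have t0 : 0 < (Num.truncn T)%:R :> R.
    by rewrite ltr0n truncn_gt_nat (ltW (lt_trans _ T2))// ltr1n.
  apply/andP; split; last by rewrite subr_le0 ler_ln ?posrE.
  rewrite lerNl opprB -ln_div ?posrE//.
  have := @le_ln1Dx R (T / (Num.truncn T)%:R - 1).
  rewrite addrCA subrr addr0 => /(_ _)/le_trans; apply.
    by rewrite ltrBrDr addrC subrr divr_gt0.
  rewrite lerBlDr ler_pdivrMr//.
  move: t2; rewrite -natr1 => t2.
  set y := 2 / T; set n : R := (Num.truncn T)%:R in t2 *.
  have yT : y * T = 2 by rewrite divfK// gt_eqF.
  have y1 : y <= 1 by rewrite ler_pdivrMr// mul1r ltW.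
  have y0 : 0 <= y by rewrite divr_ge0// ltW.
  have : 0 <= (y + 1) * (n - (T - 1)).
    by rewrite mulr_ge0 ?(addr_ge0 y0)//; lra.
  lra.
have c2 := squeeze_cvgr b c3 (@cvg_cst _ _ _ _ _).
have c4 := cvgD c1 (c2 _ _); rewrite addr0 in c4; apply: cvg_trans; last exact: c4.
apply: near_eq_cvg.
near=> T; rewrite /= !fctE /=.
by rewrite (big_ltn (ltn0Sn _)) invr0 add0r; ring.
Unshelve. all: by end_near.
Qed.

(** * Euler products *)

(** The integers that survive sieving by the primes below N; 0 and 1 qualify for every N, having no
    prime in [primes]. *)
Definition rough (N n : nat) := all (leq N) (primes n).

Lemma rough1 n : rough 1 n.
Proof. by apply/allP => p; rewrite mem_primes => /andP[/prime_gt0]. Qed.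

Lemma roughS N n : (0 < n)%N -> rough N.+1 n = rough N n && ~~ (prime N && (N %| n)%N).
Proof.
move=> n0; apply/allP/andP => [H|[/allP H pN] p pn].
  split; first by apply/allP => p /H /ltnW.
  apply/negP => /andP[pN dN].
  by have := H N; rewrite mem_primes pN n0 dN ltnn => /(_ isT).
rewrite ltn_neqAle H// andbT; apply: contra pN => /eqP ->.
by move: pn; rewrite mem_primes => /and3P[-> _ ->].
Qed.

Lemma roughM_prime N n : prime N -> (0 < n)%N -> rough N (N * n) = rough N n.
Proof.
move=> pN n0; apply/allP/allP => H p; last first.
  rewrite primesM ?(prime_gt0 pN)// => /orP[|/H//].
  by rewrite primes_prime// inE => /eqP ->.
by move=> pn; apply: H; rewrite primesM ?(prime_gt0 pN)// pn orbT.
Qed.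

Lemma rough_ge N n : rough N n -> (1 < n)%N -> (N <= n)%N.
Proof.
move=> /allP H n1; apply: leq_trans (dvdn_leq (ltnW n1) (pdiv_dvd n)).
by apply: H; rewrite mem_primes pdiv_prime// pdiv_dvd ltnW.
Qed.

Lemma sum_multiples (V : nmodType) (g : nat -> V) (d M : nat) : (0 < d)%N ->
  \sum_(1 <= n < M.+1 | (d %| n)%N) g n = \sum_(1 <= m < (M %/ d).+1) g (d * m)%N.
Proof.
move=> d0; elim: M => [|M IH]; first by rewrite div0n !big_geq.
rewrite divnS// big_mkcond big_nat_recr//= -big_mkcond IH /=.
case: ifPn => dM; last by rewrite add0n addr0.
rewrite add1n [RHS]big_nat_recr//=; congr (_ + g _).
by rewrite -[LHS](divnK dM) mulnC divnS// dM add1n.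
Qed.

Lemma cvg_divn d : (0 < d)%N -> (fun M => (M %/ d)%N) @ \oo --> \oo.
Proof.
move=> d0 A [N _ NA]; exists (N * d)%N => // M /= NM; apply: NA => /=.
by rewrite leq_divRL.
Qed.

Lemma cvg_to_eq (T : Type) (V : nbhsType) (f : T -> V) (F : set_system T) (l l' : V) :
  f @ F --> l -> l = l' -> f @ F --> l'.
Proof. by move=> fl <-. Qed.

Section euler_product.
Variables (K : numFieldType) (f : nat -> K) (L : K^o).
Hypothesis fM : forall m n, f (m * n)%N = f m * f n.
Hypothesis fL : (fun M => \sum_(1 <= n < M) f n : K^o) @ \oo --> L.

(* Euler's sieve: removing the multiples of a prime p from the sum over the
   p-rough integers multiplies it by 1 - f p. No absolute convergence is needed. *)
Lemma sum_rough_cvg N :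
  (fun M => \sum_(1 <= n < M | rough N.+1 n) f n : K^o) @ \oo -->
    (L * \prod_(0 <= p < N.+1 | prime p) (1 - f p) : K^o).
Proof.
elim: N => [|N IH].
  rewrite big_mkcond big_nat1/= mulr1.
  by under eq_fun do under eq_bigl do rewrite rough1.
rewrite big_mkcond big_nat_recr//= -big_mkcond /=.
have step M : \sum_(1 <= n < M.+1 | rough N.+2 n) f n =
    \sum_(1 <= n < M.+1 | rough N.+1 n) f n -
    (if prime N.+1 then f N.+1 else 0) *
      \sum_(1 <= n < (M %/ N.+1).+1 | rough N.+1 n) f n.
  apply/eqP; rewrite eq_sym subr_eq addrC; apply/eqP.
  rewrite (bigID (fun n => prime N.+1 && (N.+1 %| n)%N))/=; congr (_ + _).
    case: ifPn => pN; last first.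
      by rewrite mul0r big1// => i; rewrite andbF.
    rewrite /= (eq_bigl (fun n => (N.+1 %| n)%N && rough N.+1 n)); last first.
      by move=> i; rewrite andbC.
    rewrite big_mkcondr sum_multiples//= mulr_sumr [RHS]big_mkcond.
    apply: eq_big_nat => m /andP[m0 _].
    by rewrite roughM_prime// fM; case: ifP => // _.
  rewrite big_nat_cond [RHS]big_nat_cond; apply: eq_bigl => i.
  by case: (ltnP 0 i) => //= i0; rewrite [in RHS]roughS.
rewrite -(@cvg_shiftS (K^o)).
under eq_fun do rewrite step.
have c2 : (fun M => \sum_(1 <= n < M.+1 | rough N.+1 n) f n : K^o) @ \oo -->
    (L * \prod_(0 <= p < N.+1 | prime p) (1 - f p) : K^o).
  by move: IH; rewrite -(@cvg_shiftS (K^o)).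
have c3 := cvg_comp _ _ (cvg_divn (ltn0Sn N)) c2.
have c4 := @cvgMl_tmp _ _ _ _ _ (if prime N.+1 then f N.+1 else 0) _ c3.
apply: cvg_to_eq; first exact: (cvgB c2 (c4 _)).
by case: ifP => _; ring.
Qed.

(** After sieving by the primes below N there remain the term 1 and terms of index at least N, whose
    sum the tail bound [t] controls. Stating the limit of L times the product avoids dividing by
    L. *)
Lemma euler_product_cvg (t : nat -> K) : f 1%N = 1 ->
  (forall N M, \sum_(N <= n < M) `|f n| <= t N) -> (t : nat -> K^o) @ \oo --> (0 : K^o) ->
  (fun N => L * \prod_(0 <= p < N | prime p) (1 - f p) : K^o) @ \oo --> (1 : K^o).
Proof.
move=> f1 ft t0; apply/cvgrPdist_le => e e0.
have e2 : 0 < e / 2 by rewrite divr_gt0.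
have /cvgrPdist_le/(_ _ e2) t0' := t0.
near=> N.
have N1 : (1 < N)%N by near: N; exact: nbhs_infty_gt.
have tN : `|0 - t N| <= e / 2 by near: N; exact: t0'.
have [N' NE] : exists N', N = N'.+1 by exists N.-1; rewrite prednK// ltnW.
have := @sum_rough_cvg N'; rewrite -NE => /cvgrPdist_le/(_ _ e2) c.
near \oo => M.
have M2 : (1 < M)%N by near: M; exact: nbhs_infty_gt.
have cM : `|L * \prod_(0 <= p < N | prime p) (1 - f p) -
   \sum_(1 <= n < M | rough N n) f n| <= e / 2 by near: M.
rewrite (splitr e) -(subrKA (\sum_(1 <= n < M | rough N n) f n)).
apply: le_trans (ler_normD _ _) _; rewrite lerD//; last by rewrite distrC.
rewrite big_ltn_cond// /rough/= f1 opprD addrA subrr sub0r normrN.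
have tN' : t N <= e / 2.
  have t0N : 0 <= t N by apply: le_trans (ft N 0%N); rewrite big_geq.
  by move: tN; rewrite sub0r normrN ger0_norm.
apply: le_trans tN'; apply: le_trans (ler_norm_sum _ _ _) _.
have [MN|NM] := leqP M N.
  rewrite big_nat_cond big1.
    by apply: le_trans (ft N 0%N); rewrite big_geq.
  move=> i /andP[/andP[i1 iM] /rough_ge/(_ i1)].
  by move/leq_ltn_trans/(_ iM); rewrite ltnNge MN.
rewrite (@big_cat_nat _ _ _ N)//= ?(ltnW NM)// [X in X + _]big1_seq ?add0r.
  apply: le_trans (ft N M); rewrite big_mkcond; apply: ler_sum => i _.
  by case: ifP.
move=> i /andP[ri]; rewrite mem_index_iota => /andP[i1 iN].
by move: (rough_ge ri i1) iN; rewrite leqNgt => /negbTE ->.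
Unshelve. all: by end_near.
Qed.

End euler_product.

(** * Zeta and Dirichlet series near 1 *)

Lemma cvg_ln_nat (R : realType) : (fun n => ln (n%:R : R)) @ \oo --> +oo.
Proof.
apply/cvgryPge => A; near=> n.
rewrite -[A]expRK ler_ln ?posrE ?expR_gt0//; last first.
  by rewrite ltr0n; near: n; exact: nbhs_infty_gt.
by near: n; exact: nbhs_infty_ger.
Unshelve. all: by end_near.
Qed.

Lemma cvg_powRN_nat (R : realType) (d : R) : 0 < d ->
  (fun n => n%:R `^ (- d)) @ \oo --> (0 : R).
Proof.
move=> d0.
have c1 : (fun n => d * ln (n%:R : R)) @ \oo --> +oo.
  apply/cvgryPge => A.
  have /cvgryPge/(_ (A / d)) := @cvg_ln_nat R.
  by apply: filterS => n; rewrite ler_pdivrMr// mulrC.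
have c2 := cvg_comp _ _ c1 (@cvgr_expR R).
apply: cvg_trans c2; apply: near_eq_cvg; near=> n => /=.
rewrite /powR ifF ?mulNr// pnatr_eq0 gtn_eqF//.
by near: n; exact: nbhs_infty_gt.
Unshelve. all: by end_near.
Qed.

Lemma powR_natE (R : realType) (n : nat) (s : R) : (0 < n)%N ->
  (n%:R : R) `^ s = expR (s * ln n%:R).
Proof. by move=> n0; rewrite /powR pnatr_eq0 gtn_eqF. Qed.

Lemma powRN1D_nat (R : realType) (n : nat) (d : R) : (0 < n)%N ->
  (n%:R : R) `^ (- (1 + d)) = n%:R^-1 * n%:R `^ (- d).
Proof.
move=> n0; rewrite opprD powRD; last by rewrite pnatr_eq0 -lt0n n0 implybT.
by rewrite powR_inv1.
Qed.

Lemma powRN_nat_le1 (R : realType) (n : nat) (d : R) : 0 <= d -> (n%:R : R) `^ (- d) <= 1.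
Proof.
case: n => [|n] d0; first by rewrite /powR eqxx; case: (_ == _).
by rewrite powR_natE// expR_le1 mulNr oppr_le0 mulr_ge0// ln_ge0// ler1n.
Qed.

Lemma ln_natS_le (R : realType) (n : nat) : (0 < n)%N ->
  ln (n.+1%:R : R) - ln n%:R <= n%:R^-1.
Proof.
move=> n0; rewrite -ln_div ?posrE ?ltr0n//.
have x0 : (n%:R : R) != 0 by rewrite pnatr_eq0 -lt0n.
have -> : n.+1%:R / n%:R = 1 + n%:R^-1 :> R.
  by rewrite -natr1 mulrDl divff// mul1r.
by apply: le_ln1Dx; rewrite (@lt_le_trans _ _ 0)// ?invr_ge0// ltrN10.
Qed.

Lemma ln_natS_ge (R : realType) (n : nat) : (0 < n)%N ->
  n.+1%:R^-1 <= ln (n.+1%:R : R) - ln n%:R.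
Proof.
move=> n0; rewrite -lerN2 opprB -ln_div ?posrE ?ltr0n//.
have x0 : (n.+1%:R : R) != 0 by rewrite pnatr_eq0.
have -> : n%:R / n.+1%:R = 1 + - n.+1%:R^-1 :> R.
  by apply: (mulIf x0); rewrite mulrDl divfK// mulNr mulVf// mul1r -natr1 addrK.
by apply: le_ln1Dx; rewrite ltrN2 invf_lt1// ltr1n.
Qed.

(** Together with [powRN_nat_diff_ge] this replaces comparison with an integral: d n^(-1-d) is
    caught between consecutive differences of n^(-d), so that d zeta(1 + d) is estimated by
    telescoping. *)
Lemma powRN_nat_diff_le (R : realType) (n : nat) (d : R) : (0 < n)%N -> 0 <= d ->
  n%:R `^ (- d) - n.+1%:R `^ (- d) <= d * (n%:R : R) `^ (- (1 + d)).
Proof.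
move=> n0 d0; rewrite powRN1D_nat//.
have -> : (n.+1%:R : R) `^ (- d) = n%:R `^ (- d) * expR (- d * (ln n.+1%:R - ln n%:R)).
  by rewrite !powR_natE// -expRD; congr expR; ring.
rewrite -[X in X - _]mulr1 -mulrBr mulrCA [leRHS]mulrA [leRHS]mulrC ler_wpM2l ?powR_ge0//.
rewrite lerBlDl -lerBlDr; apply: le_trans (expR_ge1Dx _).
have := ler_wpM2l d0 (ln_natS_le R n0); lra.
Qed.

Lemma powRN_nat_diff_ge (R : realType) (n : nat) (d : R) : (0 < n)%N -> 0 <= d ->
  d * (n.+1%:R : R) `^ (- (1 + d)) <= n%:R `^ (- d) - n.+1%:R `^ (- d).
Proof.
move=> n0 d0; rewrite powRN1D_nat//.
have -> : (n%:R : R) `^ (- d) = n.+1%:R `^ (- d) * expR (d * (ln n.+1%:R - ln n%:R)).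
  by rewrite !powR_natE// -expRD; congr expR; ring.
rewrite -[X in _ - X]mulr1 -mulrBr mulrA mulrC ler_wpM2l ?powR_ge0//.
rewrite lerBrDl; apply: le_trans (expR_ge1Dx _).
by rewrite lerD2l ler_wpM2l// ln_natS_ge.
Qed.

Lemma zeta_partial_le (R : realType) (d : R) N : 0 < d ->
  \sum_(1 <= n < N) (n%:R : R) `^ (- (1 + d)) <= 1 + d^-1.
Proof.
move=> d0; case: N => [|[|N]].
- by rewrite big_geq// addr_ge0// invr_ge0 ltW.
- by rewrite big_geq// addr_ge0// invr_ge0 ltW.
rewrite big_ltn// powR1 lerD2l -[leRHS]mulr1 -ler_pdivrMl ?invr_gt0// invrK.
rewrite mulr_sumr big_add1 /=.
apply: le_trans (_ : \sum_(1 <= i < N.+1) ((i%:R : R) `^ (- d) - i.+1%:R `^ (- d)) <= _).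
  rewrite big_nat [leRHS]big_nat; apply: ler_sum => i /andP[i1 _].
  by rewrite powRN_nat_diff_ge// ltW.
rewrite (telescope_sumrB (fun i => (i%:R : R) `^ (- d)))// powR1.
by rewrite lerBlDr lerDl powR_ge0.
Qed.

Lemma zeta_cvg (R : realType) (s : R) : 1 < s ->
  (fun N => \sum_(1 <= n < N) (n%:R : R) `^ (- s)) @ \oo --> zeta s.
Proof.
move=> s1; have d0 : 0 < s - 1 by rewrite subr_gt0.
have se : s = 1 + (s - 1) by rewrite addrC subrK.
have e : (fun N => \sum_(1 <= n < N.+1) (n%:R : R) `^ (- s)) =
    series (fun n => n.+1%:R `^ (- s)).
  by apply/funext => N; rewrite big_add1.
rewrite -(@cvg_shiftS R) e; apply: nondecreasing_is_cvgn.
  by apply/nondecreasing_seqP => n; rewrite !seriesEnat/= big_nat_recr//= lerDl powR_ge0.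
exists (1 + (s - 1)^-1) => _ [n _ <-]; rewrite -e {1}se; exact: zeta_partial_le.
Qed.

Lemma zeta_le (R : realType) (d : R) : 0 < d -> zeta (1 + d) <= 1 + d^-1.
Proof.
move=> d0; have c : (1 : R) < 1 + d by rewrite ltrDl.
apply: (cvgr_to_le (zeta_cvg c)); near=> N; exact: zeta_partial_le.
Unshelve. all: by end_near.
Qed.

Lemma zeta_ge (R : realType) (d : R) : 0 < d -> d^-1 <= zeta (1 + d).
Proof.
move=> d0; have c : (1 : R) < 1 + d by rewrite ltrDl.
have c1 : (fun N => d^-1 * (1 - (N%:R : R) `^ (- d))) @ \oo --> d^-1.
  apply: cvg_to_eq.
    by apply: cvgMl_tmp; apply: cvgB; [exact: cvg_cst|exact: cvg_powRN_nat].
  by rewrite subr0 mulr1.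
apply: (ler_cvg_to c1 (zeta_cvg c)); near=> N.
have N0 : (0 < N)%N by near: N; exact: nbhs_infty_gt.
rewrite ler_pdivrMl//.
have -> : 1 - N%:R `^ (- d) = \sum_(1 <= i < N) ((i%:R : R) `^ (- d) - i.+1%:R `^ (- d)).
  by rewrite (telescope_sumrB (fun i => (i%:R : R) `^ (- d)))// powR1.
rewrite mulr_sumr big_nat [leRHS]big_nat; apply: ler_sum => i /andP[i1 _].
by rewrite powRN_nat_diff_le// ltW.
Unshelve. all: by end_near.
Qed.

(** The pole is normalised by 1 - exp(-d) instead of d because - ln (1 - exp(-d)) is exactly the
    Laplace transform of the harmonic measure. *)
Lemma zeta_residue (R : realType) :
  zeta (1 + d) * (1 - expR (- d)) @[d --> (0 : R)^'+] --> (1 : R).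
Proof.
have b : \forall d \near (0 : R)^'+, (1 + d)^-1 <= zeta (1 + d) * (1 - expR (- d)) <= 1 + d.
  near=> d.
  have d0 : 0 < d by near: d; exact: nbhs_right_gt.
  have e1 : expR (- d) <= (1 + d)^-1.
    by rewrite expRN lef_pV2 ?posrE ?expR_gt0 ?addr_gt0// expR_ge1Dx.
  have e2 : 1 - d <= expR (- d) := expR_ge1Dx _.
  have z1 := zeta_le d0; have z2 := zeta_ge d0.
  have dV : d * d^-1 = 1 by rewrite divff// gt_eqF.
  have d1V : (1 + d) * (1 + d)^-1 = 1 by rewrite divff// gt_eqF// addr_gt0.
  have e3 : d * (1 + d)^-1 <= 1 - expR (- d) by lra.
  have d1 : 0 < (1 + d)^-1 by rewrite invr_gt0 addr_gt0.
  have e4 : 0 <= 1 - expR (- d) by apply: le_trans e3; rewrite mulr_ge0 ?ltW.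
  apply/andP; split.
    apply: le_trans (_ : d^-1 * (d * (1 + d)^-1) <= _).
      by rewrite mulrA [_ * d]mulrC dV mul1r.
    by rewrite ler_pM// ?invr_ge0 ?mulr_ge0 ?ltW.
  apply: le_trans (_ : (1 + d^-1) * d <= _); last by rewrite mulrDl mulVf ?gt_eqF// mul1r addrC.
  have z0 : 0 <= zeta (1 + d) by apply: le_trans z2; rewrite invr_ge0 ltW.
  by rewrite ler_pM //; lra.
have c1 : 1 + d @[d --> (0 : R)^'+] --> (1 : R).
  by apply: cvg_to_eq; [apply: cvgD; [exact: cvg_cst|exact: cvg_id_right0]|rewrite addr0].
have c2 : (1 + d)^-1 @[d --> (0 : R)^'+] --> (1 : R).
  by apply: cvg_to_eq; [apply: cvgV c1; rewrite oner_neq0|rewrite invr1].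
exact: (squeeze_cvgr b c2 c1).
Unshelve. all: by end_near.
Qed.

Definition zeta_tail (R : realType) (s : R) N := zeta s - \sum_(0 <= n < N) n%:R `^ (- s).

Lemma zeta_cvg0 (R : realType) (s : R) : 1 < s ->
  (fun N => \sum_(0 <= n < N) (n%:R : R) `^ (- s)) @ \oo --> zeta s.
Proof.
move=> s1; apply: cvg_trans (zeta_cvg s1); apply: near_eq_cvg; near=> N.
have N0 : (0 < N)%N by near: N; exact: nbhs_infty_gt.
by rewrite [RHS]big_ltn// powR0 ?add0r// oppr_eq0 gt_eqF// (lt_trans _ s1).
Unshelve. all: by end_near.
Qed.

Lemma zeta_tail_ge (R : realType) (s : R) N M : 1 < s ->
  \sum_(N <= n < M) (n%:R : R) `^ (- s) <= zeta_tail s N.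
Proof.
move=> s1; rewrite lerBrDl; apply: (cvgr_to_ge (zeta_cvg0 s1)); near=> K.
have NK : (N <= K)%N by near: K; exact: nbhs_infty_ge.
have MK : (M <= K)%N by near: K; exact: nbhs_infty_ge.
rewrite [leRHS](@big_cat_nat _ _ _ N)//= lerD2l.
have [NM|/ltnW MN] := leqP N M; last by rewrite big_geq// sumr_ge0// => i _; exact: powR_ge0.
rewrite [leRHS](@big_cat_nat _ _ _ M)//= lerDl sumr_ge0// => i _; exact: powR_ge0.
Unshelve. all: by end_near.
Qed.

Lemma zeta_tail_cvg (R : realType) (s : R) : 1 < s -> zeta_tail s @ \oo --> 0.
Proof.
move=> s1; rewrite -(subrr (zeta s)).
by apply: cvgB; [exact: cvg_cst|exact: zeta_cvg0].
Qed.

Lemma abel_summation (R : comNzRingType) (b c : nat -> R) N :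
  \sum_(1 <= n < N.+1) b n * c n =
  (\sum_(1 <= k < N.+1) b k) * c N +
  \sum_(1 <= n < N) (\sum_(1 <= k < n.+1) b k) * (c n - c n.+1).
Proof.
elim: N => [|[|N] IH]; first by rewrite !big_geq// mul0r addr0.
  by rewrite !big_nat1 big_geq// addr0.
rewrite big_nat_recr// IH [in RHS]big_nat_recr//= [X in _ = _ + X]big_nat_recr//=.
ring.
Qed.

(** * Dirichlet series with bounded coefficient sums *)

Section dirichlet_test.
Variables (R : realType) (b : nat -> R) (B : R).
Hypothesis bB : forall n, `|\sum_(1 <= k < n) b k| <= B.

Lemma abel_bound (c : nat -> R) N :
  `|\sum_(1 <= n < N.+1) b n * c n| <=
  B * (`|c N| + \sum_(1 <= n < N) `|c n - c n.+1|).
Proof.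
rewrite abel_summation mulrDr; apply: le_trans (ler_normD _ _) _.
apply: lerD; first by rewrite normrM ler_wpM2r.
rewrite mulr_sumr; apply: le_trans (ler_norm_sum _ _ _) _.
by apply: ler_sum => i _; rewrite normrM ler_wpM2r.
Qed.

Lemma abel_bound_mono (c : nat -> R) N :
  (forall n, (0 < n)%N -> c n.+1 <= c n) -> (forall n, (0 < n)%N -> 0 <= c n) ->
  `|\sum_(1 <= n < N) b n * c n| <= B * c 1%N.
Proof.
move=> cd c0.
have B0 : 0 <= B by apply: le_trans (bB 0).
case: N => [|[|N]]; [by rewrite big_geq// normr0 mulr_ge0// c0..|].
apply: le_trans (abel_bound _ _) _; rewrite ler_wpM2l// ger0_norm ?c0//.
rewrite (eq_big_nat _ _ (F2 := fun n => c n - c n.+1)); last first.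
  by move=> i /andP[i1 _]; rewrite ger0_norm// subr_ge0 cd.
by rewrite telescope_sumrB// addrC subrK.
Qed.

Lemma dirichlet_test (c : nat -> R) :
  (forall n, (0 < n)%N -> c n.+1 <= c n) -> c @ \oo --> 0 ->
  cvgn (fun N => \sum_(1 <= n < N) b n * c n).
Proof.
move=> cd c0.
have B0 : 0 <= B by apply: le_trans (bB 0).
have c1 : cvgn (fun N => \sum_(1 <= n < N) (\sum_(1 <= k < n.+1) b k) * (c n - c n.+1)).
  pose u n := (\sum_(1 <= k < n.+2) b k) * (c n.+1 - c n.+2).
  have cu : cvgn (series u).
    apply: normed_cvg; apply: (@series_le_cvg _ _ (fun n => B * (c n.+1 - c n.+2))).
    - move=> n; exact: normr_ge0.
    - by move=> n; rewrite mulr_ge0// subr_ge0 cd.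
    - by move=> n; rewrite /u /= normrM [X in _ * X]ger0_norm ?subr_ge0 ?cd// ler_wpM2r// subr_ge0 cd.
    have -> : series (fun n => B * (c n.+1 - c n.+2)) = (fun N => B * (c 1%N - c N.+1)).
      apply/funext => N; rewrite seriesEnat/= -mulr_sumr; congr (_ * _).
      by rewrite (telescope_sumrB (fun n => c n.+1)).
    apply: is_cvgMl_tmp; apply: is_cvgB; first exact: is_cvg_cst.
    by apply/cvg_ex; exists 0; rewrite (@cvg_shiftS R c).
  move/cvg_ex : cu => [l ul]; apply/cvg_ex; exists l.
  rewrite -(@cvg_shiftS R); apply: cvg_trans ul; apply: near_eq_cvg.
  by near=> N; rewrite /= [in RHS]big_add1.
have c2 : (fun N => (\sum_(1 <= k < N.+1) b k) * c N) @ \oo --> 0.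
  apply/cvgr0Pnorm_le => e e0.
  have eB : 0 < e / (B + 1) by rewrite divr_gt0// ltr_wpDl.
  move/cvgr0Pnorm_le : c0 => /(_ _ eB); apply: filterS => N cN.
  rewrite normrM; apply: le_trans (_ : B * (e / (B + 1)) <= _); first by rewrite ler_pM.
  by rewrite mulrCA ler_piMr// ?(ltW e0)// ler_pdivrMr ?ltr_wpDl// mul1r lerDl.
move/cvg_ex : c1 => [l c1]; apply/cvg_ex; exists (0 + l).
rewrite -(@cvg_shiftS R); under eq_fun do rewrite abel_summation.
exact: cvgD c2 c1.
Unshelve. all: by end_near.
Qed.

Lemma dirichlet_series_cvg (s : R) : 0 < s ->
  cvgn (fun N => \sum_(1 <= n < N) b n * n%:R `^ (- s)).
Proof.
move=> s0; apply: dirichlet_test; last exact: cvg_powRN_nat.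
move=> n n0; rewrite !powR_natE// ler_expR !mulNr lerN2 ler_wpM2l ?(ltW s0)//.
by rewrite ler_ln ?posrE ?ltr0n// ler_nat.
Qed.

(* The majorant telescopes against (2 + ln n) / n. *)
Lemma powRN_variation (d : R) N : 0 <= d ->
  `|N%:R `^ (- (1 + d)) - (N%:R : R) `^ (- 1)| +
   \sum_(1 <= n < N) `|((n%:R : R) `^ (- (1 + d)) - n%:R `^ (- 1)) -
     (n.+1%:R `^ (- (1 + d)) - n.+1%:R `^ (- 1))| <= 3 * d.
Proof.
move=> d0.
have pd n : (0 < n)%N -> 0 <= 1 - (n%:R : R) `^ (- d) <= d * ln n%:R.
  move=> n0; rewrite subr_ge0 powRN_nat_le1//= lerBlDr -lerBlDl.
  by rewrite powR_natE// mulNr expR_ge1Dx.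
have e n : (0 < n)%N -> (n%:R : R) `^ (- (1 + d)) - n%:R `^ (- 1) = - (n%:R^-1 * (1 - n%:R `^ (- d))).
  by move=> n0; rewrite powRN1D_nat// powR_inv1//; ring.
have term n : (0 < n)%N -> `|((n%:R : R) `^ (- (1 + d)) - n%:R `^ (- 1)) -
     (n.+1%:R `^ (- (1 + d)) - n.+1%:R `^ (- 1))| <=
     d * ((2 + ln n%:R) / n%:R - (2 + ln n.+1%:R) / n.+1%:R).
  move=> n0; rewrite !e//.
  have n0' : 0 < (n%:R : R) by rewrite ltr0n.
  have n1' : 0 < (n.+1%:R : R) by rewrite ltr0n.
  (* The variations of n^(-d) and of 1/n are separated; together they cost at most d (1 + ln n) / (n
     (n + 1)). The 2 in the majorant leaves room for ln (n + 1) - ln n <= 1/n. *)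
  have -> : - (n%:R^-1 * (1 - n%:R `^ (- d))) - - (n.+1%:R^-1 * (1 - n.+1%:R `^ (- d))) =
     n.+1%:R^-1 * (n%:R `^ (- d) - n.+1%:R `^ (- d)) -
     (n%:R^-1 - n.+1%:R^-1) * (1 - (n%:R : R) `^ (- d)) by ring.
  have nn : (n%:R^-1 - n.+1%:R^-1 : R) = n%:R^-1 * n.+1%:R^-1.
    by rewrite -natr1; field; rewrite natr1 !gt_eqF.
  have l1 := ln_natS_le R n0; have l2 := ln_natS_ge R n0.
  have x1 := powRN_nat_diff_le n0 d0; have x2 := powRN_nat_diff_ge n0 d0.
  have /andP[y1 y2] := pd _ n0.
  apply: le_trans (ler_normB _ _) _.
  have z1 : 0 <= n%:R `^ (- d) - (n.+1%:R : R) `^ (- d).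
    by apply: le_trans x2; rewrite mulr_ge0 ?powR_ge0.
  have x1' : n%:R `^ (- d) - (n.+1%:R : R) `^ (- d) <= d * n%:R^-1.
    apply: le_trans x1 _; rewrite ler_wpM2l// powRN1D_nat// ler_piMr ?invr_ge0//.
    exact: powRN_nat_le1.
  rewrite !normrM !ger0_norm ?invr_ge0// ?nn ?mulr_ge0 ?invr_ge0//.
  apply: le_trans (_ : n.+1%:R^-1 * (d * n%:R^-1) + n%:R^-1 * n.+1%:R^-1 * (d * ln n%:R) <= _).
    by rewrite lerD// ler_wpM2l// ?mulr_ge0 ?invr_ge0.
  have -> : n.+1%:R^-1 * (d * n%:R^-1) + n%:R^-1 * n.+1%:R^-1 * (d * ln n%:R) =
    d * (n.+1%:R^-1 * n%:R^-1 * (1 + ln n%:R) : R) by ring.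
  rewrite ler_wpM2l//.
  have n1V : 0 <= (n.+1%:R : R)^-1 by rewrite invr_ge0.
  have h1 : n.+1%:R^-1 * (ln n.+1%:R - ln n%:R) <= n.+1%:R^-1 * (n%:R : R)^-1.
    by rewrite ler_wpM2l.
  have -> : (2 + ln n%:R) / n%:R - (2 + ln n.+1%:R) / n.+1%:R =
    (2 + ln n%:R) * (n%:R^-1 - n.+1%:R^-1) - n.+1%:R^-1 * (ln n.+1%:R - ln n%:R) :> R by ring.
  rewrite nn; move: h1; move: (n.+1%:R^-1 : R) (n%:R^-1 : R) (ln n%:R : R) (ln n.+1%:R : R) => x y l l' h1; lra.
(* The boundary term costs 1, since ln N <= N; the telescoped sum costs 2, the value of (2 + ln n) /
   n at n = 1. *)
have D : d * 3 = d + d * 2 by ring.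
rewrite mulrC D; apply: lerD.
  case: N => [|N].
    by rewrite !powR0 ?subrr ?normr0// oppr_eq0 gt_eqF// ltr_wpDr.
  rewrite e// normrN; have /andP[y1 y2] := pd N.+1 isT.
  rewrite ger0_norm ?mulr_ge0 ?invr_ge0// ler_pdivrMl ?ltr0n//.
  apply: le_trans y2 _; rewrite mulrC ler_wpM2r//.
  by rewrite ltW// ln_sublinear.
case: N => [|[|N]]; [by rewrite big_geq// mulr_ge0..|].
apply: le_trans (_ : \sum_(1 <= n < N.+2) d * ((2 + ln n%:R) / n%:R - (2 + ln n.+1%:R) / n.+1%:R) <= _).
  by rewrite big_nat [leRHS]big_nat; apply: ler_sum => i /andP[i0 _]; exact: term.
rewrite -mulr_sumr ler_wpM2l//.
rewrite (telescope_sumrB (fun n => (2 + ln (n%:R : R)) / n%:R))//.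
rewrite ln1 addr0 invr1 mulr1 gerBl divr_ge0// addr_ge0// ln_ge0 ?ler1n//.
Qed.

(** Abel summation against the difference of the two weights, whose total variation is at most 3 d.
    Continuity would not suffice later: a zero at 1 must produce a factor O(d) to set against the
    pole of zeta. *)
Lemma dirichlet_series_lipschitz (d : R) : 0 < d ->
  `|limn (fun N => \sum_(1 <= n < N) b n * n%:R `^ (- (1 + d))) -
    limn (fun N => \sum_(1 <= n < N) b n * n%:R `^ (- 1))| <= B * (3 * d).
Proof.
move=> d0.
have B0 : 0 <= B by apply: le_trans (bB 0).
have c1 := @dirichlet_series_cvg (1 + d) (addr_gt0 ltr01 d0).
have c2 := @dirichlet_series_cvg 1 ltr01.
have c3 := cvg_norm (cvgB c1 c2).
apply: (cvgr_to_le (c3 _ _)); near=> N => /=; rewrite !fctE.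
have [N' ->] : exists N', N = N'.+1.
  by exists N.-1; rewrite prednK//; near: N; exact: nbhs_infty_gt.
rewrite -sumrB; under eq_bigr do rewrite -mulrBr.
apply: le_trans (abel_bound _ _) _; rewrite ler_wpM2l//.
by apply: powRN_variation; exact: ltW.
Unshelve. all: by end_near.
Qed.

End dirichlet_test.

(** * Nonvanishing for real characters *)

Section divisor_sum.
Variables (R : realType) (chi : nat -> R).
Hypothesis chi1 : chi 1%N = 1.
Hypothesis chiM : forall m n, chi (m * n)%N = chi m * chi n.
Hypothesis chi_real : forall n, [|| chi n == 0, chi n == 1 | chi n == -1].

Definition divisor_sum (m : nat) := \sum_(1 <= d < m.+1 | (d %| m)%N) chi d.

Lemma divisor_sum_widen m M : (0 < m <= M)%N ->
  \sum_(1 <= d < M.+1 | (d %| m)%N) chi d = divisor_sum m.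
Proof.
move=> /andP[m0 mM]; rewrite /divisor_sum (@big_cat_nat _ _ _ m.+1)//=.
rewrite [X in _ + X]big1_seq ?addr0// => d /andP[dm].
by rewrite mem_index_iota ltnNge (dvdn_leq m0 dm).
Qed.

(** Divisors of p m, where m = p^e n, are either p times a divisor of m or prime to p, and the
    latter are the divisors of n. *)
Lemma divisor_sum_prime p n e : prime p -> (0 < n)%N -> coprime p n ->
  divisor_sum (p ^ e * n) = (\sum_(i < e.+1) chi p ^+ i) * divisor_sum n.
Proof.
move=> pp n0 pn; have p0 := prime_gt0 pp; elim: e => [|e IH].
  by rewrite big_ord_recl big_ord0 expr0 addr0 mul1r expn0 mul1n.
set m := (p ^ e * n)%N in IH *.
have m0 : (0 < m)%N by rewrite muln_gt0 expn_gt0 p0.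
have -> : (p ^ e.+1 * n = p * m)%N by rewrite expnS mulnA.
rewrite {1}/divisor_sum (bigID (dvdn p))/=.
have -> : \sum_(1 <= i < (p * m).+1 | (i %| p * m)%N && (p %| i)%N) chi i = chi p * divisor_sum m.
  under eq_bigl do rewrite andbC.
  rewrite big_mkcondr sum_multiples// mulKn// -big_mkcond mulr_sumr.
  by apply: eq_big => i; [rewrite dvdn_pmul2l|rewrite chiM].
rewrite big_ord_recl expr0 mulrDl mul1r IH mulrA [chi p * _]mulr_sumr addrC; congr (_ + _ * _).
  rewrite -(@divisor_sum_widen n (p * m)); last first.
    by rewrite n0/= /m mulnA leq_pmull// muln_gt0 p0 expn_gt0 p0.
  apply: eq_bigl => d; apply/andP/idP => [[dm pd]|dn].
    move: dm; rewrite /m mulnA -expnS Gauss_dvdr//.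
    by rewrite coprimeXr// coprime_sym prime_coprime.
  split; first by rewrite /m mulnA dvdn_mull.
  rewrite -prime_coprime//; apply: coprime_dvdr pn; exact: dn.
by apply: eq_bigr => i _; rewrite exprS.
Qed.

Lemma geometric_chi_ge0 p e :
  (0 <= \sum_(i < e.+1) chi p ^+ i) /\ (~~ odd e -> 1 <= \sum_(i < e.+1) chi p ^+ i).
Proof.
case/or3P: (chi_real p) => /eqP ->.
- by rewrite big_ord_recl big1 ?addr0 ?expr0// => i _; rewrite exprS mul0r.
- under eq_bigr do rewrite expr1n.
  by rewrite sumr_const card_ord; split; rewrite ?ler0n// ler1n.
- have -> : \sum_(i < e.+1) (-1) ^+ i = (~~ odd e)%:R :> R.
    elim: e => [|e IH]; first by rewrite big_ord1.
    rewrite big_ord_recr/= IH -signr_odd /=; case: (odd e) => /=.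
      by rewrite expr0 add0r.
    by rewrite expr1 subrr.
  by case: (odd e).
Qed.

Lemma divisor_sum_ge0 m : (0 < m)%N -> 0 <= divisor_sum m.
Proof.
have [k] := ubnP m; elim: k m => // k IH m mk m0.
case: (leqP m 1) => m1.
  have -> : m = 1%N by apply/eqP; rewrite eqn_leq m1.
  by rewrite /divisor_sum big_mkcond big_nat1 dvd1n chi1.
have pp := pdiv_prime m1; have pd := pdiv_dvd m.
have [n pn e] := pfactor_coprime pp m0.
have n0 : (0 < n)%N by move: m0; rewrite e muln_gt0 => /andP[].
rewrite e mulnC divisor_sum_prime// mulr_ge0//; first by have [] := geometric_chi_ge0 (pdiv m) (logn (pdiv m) m).
apply: IH => //; apply: leq_trans (mk : (m <= k)%N); rewrite [X in (_ < X)%N]e.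
rewrite ltn_Pmulr// -[X in (X < _)%N](expn0 (pdiv m)) ltn_exp2l ?prime_gt1//.
by rewrite logn_gt0 mem_primes pp m0.
Qed.

(** In a square every exponent is even, and then each local factor 1 + chi(p) + ... + chi(p)^e is at
    least 1, even for chi(p) = -1. *)
Lemma divisor_sum_square j : (0 < j)%N -> 1 <= divisor_sum (j ^ 2).
Proof.
have [k] := ubnP j; elim: k j => // k IH m mk m0.
case: (leqP m 1) => m1.
  have -> : m = 1%N by apply/eqP; rewrite eqn_leq m1.
  by rewrite /divisor_sum big_mkcond big_nat1 dvd1n chi1.
have pp := pdiv_prime m1; have pd := pdiv_dvd m.
have [n pn e] := pfactor_coprime pp m0.
have n0 : (0 < n)%N by move: m0; rewrite e muln_gt0 => /andP[].
rewrite [X in (X ^ 2)%N]e mulnC expnMn -expnM divisor_sum_prime ?expn_gt0 ?n0 ?coprimeXr//.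
rewrite -[leLHS]mul1r ler_pM//.
  by have [_] := geometric_chi_ge0 (pdiv m) (logn (pdiv m) m * 2); apply; rewrite muln2 odd_double.
apply: IH => //; apply: leq_trans (mk : (m <= k)%N); rewrite [X in (_ < X)%N]e.
rewrite ltn_Pmulr// -[X in (X < _)%N](expn0 (pdiv m)) ltn_exp2l ?prime_gt1//.
by rewrite logn_gt0 mem_primes pp m0.
Qed.

End divisor_sum.

(** * Monotonicity of the Lambert weights *)

Section lambert.
Variable (R : realType).

(** The terms i and n - 1 - i are paired by the inequality of arithmetic and geometric means. The
    mean y^(n-1) is a half-integral power of y^2, which is why the Lambert argument x is written as
    y^2 below. *)
Lemma geometric_amgm (y : R) n : 0 <= y <= 1 ->
  n%:R * y ^+ n.-1 <= \sum_(i < n) (y ^+ 2) ^+ i.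
Proof.
move=> /andP[y0 y1].
rewrite -(ler_pM2l (_ : 0 < 2))//.
have -> : 2 * \sum_(i < n) (y ^+ 2) ^+ i = \sum_(i < n) ((y ^+ i) ^+ 2 + (y ^+ (n.-1 - i)) ^+ 2).
  rewrite big_split/= mulr_natl mulr2n; congr (_ + _).
    by apply: eq_bigr => i _; rewrite exprAC.
  rewrite (reindex_inj rev_ord_inj)/=; apply: eq_bigr => i _.
  by rewrite exprAC; congr (_ ^+ _ ^+ _); have := ltn_ord i; rewrite /=; lia.
apply: le_trans (_ : \sum_(i < n) 2 * y ^+ n.-1 <= _).
  by rewrite sumr_const card_ord -[leRHS]mulr_natl mulrCA.
apply: ler_sum => i _.
have -> : y ^+ n.-1 = y ^+ i * y ^+ (n.-1 - i).
  by rewrite -exprD subnKC//; have := ltn_ord i; lia.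
by have := sqr_ge0 (y ^+ i - y ^+ (n.-1 - i)); rewrite sqrrB; lra.
Qed.

(** The first term is the main part of x^n / (1 - x^n) as x tends to 1; weighted by chi(n) and
    summed, it gives L(1, chi) / (1 - x). *)
Definition lambert_gap (x : R) (n : nat) := (n%:R * (1 - x))^-1 - x ^+ n / (1 - x ^+ n).

Variables (y : R).
Hypothesis y01 : 0 < y < 1.
Let x := y ^+ 2.
Let x01 : 0 < x < 1.
Proof. by case/andP: y01 => y0 y1; rewrite exprn_gt0//= exprn_ilt1// ltW. Qed.

Let subr1Xn n : 1 - x ^+ n = (1 - x) * \sum_(i < n) x ^+ i.
Proof. by rewrite -opprB subrX1 -mulNr opprB. Qed.

Let geom_gt0 n : (0 < n)%N -> 0 < \sum_(i < n) x ^+ i.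
Proof.
move=> n0; case/andP: y01 => y0 y1; apply: lt_le_trans (_ : n%:R * y ^+ n.-1 <= _).
  by rewrite mulr_gt0 ?ltr0n// exprn_gt0.
by apply: geometric_amgm; rewrite !ltW.
Qed.

Lemma lambert_gap_ge0 n : (0 < n)%N -> 0 <= lambert_gap x n.
Proof.
move=> n0; case/andP: x01 => x0 x1; case/andP: y01 => y0 y1.
have x1' : 0 < 1 - x by rewrite subr_gt0.
have n0' : 0 < (n%:R : R) by rewrite ltr0n.
have G0 := geom_gt0 n0.
rewrite /lambert_gap subr1Xn subr_ge0 ler_pdivrMr ?mulr_gt0//.
rewrite invfM -mulrA mulKf ?gt_eqF// ler_pdivlMl//.
apply: le_trans (geometric_amgm n _); last by rewrite !ltW.
rewrite ler_wpM2l// /x -exprM.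
by rewrite ler_wiXn2l ?ltW//; case: (n) n0 => //= m _; rewrite mul2n -addnn; lia.
Qed.

(** With G_n = 1 + x + ... + x^(n-1), the claim reduces to n (n + 1) x^n <= G_n G_(n+1). Two uses of
    [geometric_amgm] bound the right-hand side below by n (n + 1) y^(2n-1), and x^n = y^(2n). *)
Lemma lambert_gap_decr n : (0 < n)%N -> lambert_gap x n.+1 <= lambert_gap x n.
Proof.
move=> n0; case/andP: x01 => x0 x1; case/andP: y01 => y0 y1.
have x1' : 0 < 1 - x by rewrite subr_gt0.
have n0' : 0 < (n%:R : R) by rewrite ltr0n.
have G0 := geom_gt0 n0; have G1 := geom_gt0 (ltn0Sn n).
rewrite -subr_ge0 /lambert_gap !subr1Xn.
have g : n%:R * n.+1%:R * x ^+ n <= (\sum_(i < n) x ^+ i) * \sum_(i < n.+1) x ^+ i.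
  apply: le_trans (_ : (n%:R * y ^+ n.-1) * (n.+1%:R * y ^+ n) <= _); last first.
    rewrite ler_pM ?mulr_ge0 ?exprn_ge0 ?(ltW y0)//; first by apply: geometric_amgm; rewrite !ltW.
    by apply: (@geometric_amgm y n.+1); rewrite !ltW.
  rewrite mulrACA ler_wpM2l// -exprD /x -exprM.
  by rewrite ler_wiXn2l ?ltW//; case: (n) n0 => //= m _; lia.
have Gr : \sum_(i < n.+1) x ^+ i = \sum_(i < n) x ^+ i + x ^+ n by rewrite big_ord_recr.
have Gx : (1 - x) * \sum_(i < n) x ^+ i = 1 - x ^+ n by rewrite subr1Xn.
set G := \sum_(i < n) x ^+ i in G0 g Gr Gx *.
set G' := \sum_(i < n.+1) x ^+ i in G1 g Gr *.
have -> : (n%:R * (1 - x))^-1 - x ^+ n / ((1 - x) * G) -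
   ((n.+1%:R * (1 - x))^-1 - x ^+ n.+1 / ((1 - x) * G')) =
   (1 - x)^-1 * ((n%:R * n.+1%:R)^-1 - x ^+ n / (G * G')).
  have -> : (n%:R * n.+1%:R : R)^-1 = n%:R^-1 - n.+1%:R^-1.
    by rewrite -natr1; field; rewrite natr1 !gt_eqF// ltr0n.
  have -> : x ^+ n / (G * G') = x ^+ n / G - x ^+ n.+1 / G'.
    have e : x ^+ n * (G' - x * G) = x ^+ n.
      by rewrite Gr addrAC -[X in X - _]mul1r -mulrBl Gx subrK mulr1.
    rewrite -[in LHS]e exprS; field; rewrite !gt_eqF//.
  by rewrite !invfM; ring.
rewrite mulr_ge0// ?invr_ge0 ?(ltW x1')// subr_ge0.
rewrite ler_pdivrMr ?mulr_gt0// ler_pdivlMl ?mulr_gt0 ?ltr0n//.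
Qed.

Lemma lambert_gap1 : lambert_gap x 1 = 1.
Proof.
case/andP: x01 => x0 x1; rewrite /lambert_gap mul1r expr1 -{1}[(1 - x)^-1]mul1r -mulrBl divff//.
by rewrite gt_eqF// subr_gt0.
Qed.

End lambert.

Section monsky.
Variables (R : realType) (chi : nat -> R) (B : R).
Hypothesis chi1 : chi 1%N = 1.
Hypothesis chiM : forall m n, chi (m * n)%N = chi m * chi n.
Hypothesis chi_real : forall n, [|| chi n == 0, chi n == 1 | chi n == -1].
Hypothesis chiB : forall n, `|\sum_(1 <= k < n) chi k| <= B.

Let chi_norm n : `|chi n| <= 1.
Proof. by case/or3P: (chi_real n) => /eqP ->; rewrite ?normr0 ?normr1 ?normrN1. Qed.

Lemma lambert_le (y : R) N : 0 < y < 1 ->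
  \sum_(1 <= n < N) chi n * ((y ^+ 2) ^+ n / (1 - (y ^+ 2) ^+ n)) <=
  (1 - y ^+ 2)^-1 * `|\sum_(1 <= n < N) chi n * n%:R `^ (- 1)| + B.
Proof.
move=> y01; have /andP[y0 y1] := y01.
have x1 : 0 < 1 - y ^+ 2 by rewrite subr_gt0 exprn_ilt1// ltW.
have -> : \sum_(1 <= n < N) chi n * ((y ^+ 2) ^+ n / (1 - (y ^+ 2) ^+ n)) =
  (1 - y ^+ 2)^-1 * \sum_(1 <= n < N) chi n * n%:R `^ (- 1) -
  \sum_(1 <= n < N) chi n * lambert_gap (y ^+ 2) n.
  rewrite mulr_sumr -sumrB; apply: eq_bigr => n _.
  by rewrite /lambert_gap powR_inv1// invfM; ring.
apply: lerD; first by rewrite ler_wpM2l ?invr_ge0 ?(ltW x1)// ler_norm.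
rewrite lerNl; apply: le_trans (_ : - `|\sum_(1 <= n < N) chi n * lambert_gap (y ^+ 2) n| <= _).
  rewrite lerN2 -[leRHS]mulr1 -(lambert_gap1 y01).
  apply: (abel_bound_mono chiB) => n n0; first exact: lambert_gap_decr.
  exact: lambert_gap_ge0.
by rewrite lerNl -normrN ler_norm.
Qed.

(** A finite form of the rearrangement of the Lambert series by m = n k. Cutting the geometric
    series in x^n at exponents n k <= M loses at most x^(M+1) / (1 - x) for each n. *)
Lemma lambert_ge (x : R) M : 0 < x < 1 ->
  \sum_(1 <= m < M.+1) divisor_sum chi m * x ^+ m - M%:R * (x ^+ M.+1 / (1 - x)) <=
  \sum_(1 <= n < M.+1) chi n * (x ^+ n / (1 - x ^+ n)).
Proof.
move=> /andP[x0 x1].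
have -> : \sum_(1 <= m < M.+1) divisor_sum chi m * x ^+ m =
    \sum_(1 <= n < M.+1) chi n * \sum_(1 <= k < (M %/ n).+1) x ^+ (n * k).
  transitivity (\sum_(1 <= m < M.+1) \sum_(1 <= n < M.+1) (if (n %| m)%N then chi n * x ^+ m else 0)).
    rewrite big_nat [RHS]big_nat; apply: eq_bigr => m /andP[m0 mM].
    rewrite -(@divisor_sum_widen R chi m M) ?m0// -big_mkcond mulr_suml.
    by apply: eq_bigr.
  rewrite exchange_big /= big_nat [RHS]big_nat; apply: eq_bigr => n /andP[n0 nM].
  rewrite -big_mkcond -mulr_sumr; congr (_ * _).
  by rewrite (sum_multiples (fun m => x ^+ m)).
rewrite lerBlDr -lerBlDl -sumrB.
apply: le_trans (_ : \sum_(1 <= n < M.+1) (x ^+ M.+1 / (1 - x)) <= _); last first.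
  by rewrite sumr_const_nat subn1 /= -[leLHS]mulr_natl.
rewrite big_nat [leRHS]big_nat; apply: ler_sum => n /andP[n0 nM].
have z0 : 0 < x ^+ n by rewrite exprn_gt0.
have zx : x ^+ n <= x by rewrite -[leRHS]expr1 ler_wiXn2l// ltW.
have z1 : x ^+ n < 1 by apply: le_lt_trans x1.
have -> : \sum_(1 <= k < (M %/ n).+1) x ^+ (n * k) =
    (x ^+ n - x ^+ (n * (M %/ n).+1)) / (1 - x ^+ n).
  apply: (@mulIf _ (1 - x ^+ n)); first by rewrite gt_eqF// subr_gt0.
  rewrite divfK ?gt_eqF ?subr_gt0// mulr_suml.
  under eq_bigr => k _ do rewrite mulrBr mulr1 -exprD -mulnSr.
  by rewrite (telescope_sumrB (fun k => x ^+ (n * k)))// muln1.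
rewrite -mulrBr -mulrBl addrAC subrr add0r mulNr mulrN.
apply: le_trans (ler_norm _) _; rewrite normrN normrM.
rewrite -[leRHS]mul1r ler_pM// ger0_norm; last first.
  by rewrite divr_ge0 ?exprn_ge0 ?subr_ge0 ?ltW.
rewrite ler_pM ?invr_ge0 ?exprn_ge0 ?(ltW x0) ?subr_ge0 ?(ltW z1)//.
  by rewrite ler_wiXn2l ?(ltW x0) ?(ltW x1)// mulnC ltn_ceil.
by rewrite lef_pV2 ?posrE ?subr_gt0// lerD2l lerN2.
Qed.

Lemma divisor_sum_power_ge (x : R) J : 0 < x < 1 ->
  \sum_(1 <= j < J.+1) x ^+ (j ^ 2) <= \sum_(1 <= m < (J ^ 2).+1) divisor_sum chi m * x ^+ m.
Proof.
move=> /andP[x0 x1]; elim: J => [|J IH]; first by rewrite !big_geq.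
rewrite big_nat_recr//=.
have JJ : ((J ^ 2).+1 <= J.+1 ^ 2)%N by rewrite ltn_exp2r.
rewrite [leRHS]big_nat_recr ?expn_gt0//= [X in _ <= X + _](@big_cat_nat _ _ _ (J ^ 2).+1)//=.
apply: lerD; last first.
  by rewrite -[leLHS]mul1r ler_wpM2r ?exprn_ge0 ?(ltW x0)// divisor_sum_square.
apply: le_trans IH _; rewrite lerDl big_nat; apply: sumr_ge0 => i /andP[i1 _].
by rewrite mulr_ge0 ?exprn_ge0 ?(ltW x0)// divisor_sum_ge0// (leq_trans _ i1).
Qed.

(* Monsky: if L(1, chi) = 0, the Lambert series sum chi(n) x^n / (1 - x^n) is
   bounded as x -> 1, by Abel summation against lambert_gap; but it equals
   sum divisor_sum(m) x^m, which dominates sum x^(j^2). *)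
Lemma real_character_L1_neq0 :
  limn (fun N => \sum_(1 <= n < N) chi n * n%:R `^ (- 1)) != 0.
Proof.
apply/eqP => L0.
have cA := @dirichlet_series_cvg R chi B chiB 1 ltr01; rewrite L0 in cA.
have B0 : 0 <= B by apply: le_trans (chiB 0).
(* J exceeds 2 B. The argument x = y^2 satisfies 1 - x = 1 / (2 J^2), so Bernoulli gives x^(J^2) >=
   1/2 and the squares up to J^2 contribute at least J / 2 > B. It stays fixed while M tends to
   infinity. *)
pose J := (Num.truncn (2 * B)).+1.
have JB : 2 * B < J%:R by rewrite real_truncnS_gt// num_real.
pose x1 : R := (2 * (J ^ 2)%:R)^-1.
have JJ0 : 0 < ((J ^ 2)%:R : R) by rewrite ltr0n expn_gt0.
have x1p : 0 < x1 by rewrite invr_gt0 mulr_gt0.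
have x1h : (J ^ 2)%:R * x1 = 2^-1 by rewrite /x1 invfM mulrCA divff ?mulr1// gt_eqF.
have x12 : x1 <= 2^-1.
  by rewrite -x1h ler_peMl ?(ltW x1p)// ler1n expn_gt0.
pose y := Num.sqrt (1 - x1).
have y2 : y ^+ 2 = 1 - x1 by rewrite sqr_sqrtr; lra.
have y01 : 0 < y < 1.
  have h0 : 0 < 1 - x1 by lra.
  rewrite sqrtr_gt0 h0/= -(@ltr_pXn2r _ 2)// ?nnegrE ?sqrtr_ge0// y2 expr1n; lra.
have /andP[y0 y1] := y01.
have xx : 0 < y ^+ 2 < 1 by rewrite y2; lra.
have step M : (J ^ 2 <= M)%N ->
  J%:R * (y ^+ 2) ^+ (J ^ 2) <=
   (1 - y ^+ 2)^-1 * `|\sum_(1 <= n < M.+1) chi n * n%:R `^ (- 1)| + B +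
   M%:R * ((y ^+ 2) ^+ M.+1 / (1 - y ^+ 2)).
  move=> JM; have h1 := lambert_le M.+1 y01; have h2 := lambert_ge M xx.
  have h3 := divisor_sum_power_ge J xx.
  have h4 : \sum_(1 <= m < (J ^ 2).+1) divisor_sum chi m * (y ^+ 2) ^+ m <=
     \sum_(1 <= m < M.+1) divisor_sum chi m * (y ^+ 2) ^+ m.
    rewrite [leRHS](@big_cat_nat _ _ _ (J ^ 2).+1)//= lerDl big_nat.
    apply: sumr_ge0 => i /andP[i1 _].
    have yi : 0 <= (y ^+ 2) ^+ i by rewrite exprn_ge0// sqr_ge0.
    by rewrite mulr_ge0// divisor_sum_ge0// (leq_trans _ i1).
  have h5 : J%:R * (y ^+ 2) ^+ (J ^ 2) <= \sum_(1 <= j < J.+1) (y ^+ 2) ^+ (j ^ 2).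
    have -> : J%:R * (y ^+ 2) ^+ (J ^ 2) = \sum_(1 <= j < J.+1) (y ^+ 2) ^+ (J ^ 2).
      by rewrite sumr_const_nat subn1 /= -[RHS]mulr_natl.
    rewrite big_nat [leRHS]big_nat; apply: ler_sum => j /andP[j1 jJ].
    case/andP: xx => xx0 xx1.
    by rewrite ler_wiXn2l ?ltW// leq_exp2r.
  move: h1 h2 h3 h4 h5; lra.
have lo : J%:R * 2^-1 <= J%:R * (y ^+ 2) ^+ (J ^ 2).
  rewrite ler_wpM2l// y2.
  apply: le_trans (subr1_expn_ge _ _); first by rewrite x1h; lra.
  by apply/andP; split; lra.
(* Bernoulli for 1/y yields M (1/y - 1) <= y^(-M), so half of the decay y^(2M) absorbs the factor
   M. *)
have lim0 : (fun M => M%:R * ((y ^+ 2) ^+ M.+1 / (1 - y ^+ 2))) @ \oo --> 0.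
  have h : 0 < y^-1 - 1 by rewrite subr_gt0 invf_gt1.
  pose C := (y^-1 - 1)^-1 / (1 - y ^+ 2).
  have c1 : (fun M => C * y ^+ M) @ \oo --> 0.
    apply: cvg_to_eq; first by apply: cvgMl_tmp; apply: cvg_expr; rewrite gtr0_norm.
    by rewrite mulr0.
  have b : \forall M \near \oo, 0 <= M%:R * ((y ^+ 2) ^+ M.+1 / (1 - y ^+ 2)) <= C * y ^+ M.
    near=> M; apply/andP; split.
      by rewrite mulr_ge0// divr_ge0 ?exprn_ge0 ?(ltW y0)// subr_ge0 ltW//; case/andP: xx.
    rewrite /C mulrA [leRHS]mulrAC ler_wpM2r//.
      by rewrite invr_ge0 subr_ge0 ltW//; case/andP: xx.
    rewrite ler_pdivlMl//.
    have := @addr1_expn_ge R (y^-1 - 1) M (ltW h).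
    rewrite addrCA subrr addr0 exprVn => h1.
    have yM : 0 < y ^+ M by rewrite exprn_gt0.
    have h2 : (y^-1 - 1) * M%:R * y ^+ M <= 1.
      by rewrite -ler_pdivlMr// div1r mulrC; lra.
    have h3 : (y ^+ 2) ^+ M.+1 <= y ^+ M * y ^+ M.
      by rewrite -exprM -exprD ler_wiXn2l ?(ltW y0) ?(ltW y1)// mul2n -addnn leq_add.
    apply: le_trans (_ : (y^-1 - 1) * (M%:R * (y ^+ M * y ^+ M)) <= _).
      by rewrite ler_wpM2l ?(ltW h)// ler_wpM2l.
    by rewrite !mulrA -[leRHS]mul1r ler_wpM2r// ltW.
  exact: (squeeze_cvgr b (@cvg_cst _ _ _ _ _) c1).
have lim1 : (fun M => (1 - y ^+ 2)^-1 * `|\sum_(1 <= n < M.+1) chi n * n%:R `^ (- 1)| + B +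
   M%:R * ((y ^+ 2) ^+ M.+1 / (1 - y ^+ 2))) @ \oo --> B.
  apply: cvg_to_eq.
    apply: cvgD; [apply: cvgD; [|exact: cvg_cst]|exact: lim0].
    by apply: cvgMl_tmp; apply: cvg_norm; rewrite (@cvg_shiftS R (fun M => \sum_(1 <= n < M) chi n * n%:R `^ (- 1))); exact: cA.
  by rewrite normr0 mulr0 add0r addr0.
have : J%:R * (y ^+ 2) ^+ (J ^ 2) <= B.
  apply: (cvgr_to_ge lim1); near=> M; apply: step.
  by near: M; exact: nbhs_infty_ge.
lra.
Unshelve. all: by end_near.
Qed.

End monsky.

(** * Characters modulo q *)

Lemma prim_root_exists (C : numClosedFieldType) n : (0 < n)%N ->
  exists z : C, n.-primitive_root z.
Proof.
move=> n0; have [r] := closed_field_poly_normal ('X^n - 1 : {poly C}).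
rewrite (monicP _) ?monicXnsubC// scale1r => Dp.
have rn : all n.-unity_root r by apply/allP => z; rewrite -root_prod_XsubC -Dp.
have ur : uniq r by rewrite -separable_prod_XsubC -Dp separable_Xn_sub_1// pnatr_eq0 -lt0n.
have sr : (n < (size r).+1)%N by rewrite -(size_prod_XsubC r id) -Dp size_XnsubC.
by have /hasP[z _ pz] := has_prim_root n0 rn ur sr; exists z.
Qed.

Lemma prod_1sub_prim_root (F : fieldType) (n : nat) (z y : F) : n.-primitive_root z ->
  \prod_(i < n) (1 - z ^+ i * y) = 1 - y ^+ n.
Proof.
move=> zn; have n0 := prim_order_gt0 zn.
have [->|y0] := eqVneq y 0.
  by rewrite expr0n gtn_eqF// subr0 big1// => i _; rewrite mulr0 subr0.
have := congr1 (fun p => p.[y^-1]) (factor_Xn_sub_1 zn).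
rewrite hornerD hornerN hornerXn hornerC big_mkord horner_prod => e.
have -> : 1 - y ^+ n = (y^-1 ^+ n - 1) * y ^+ n.
  by rewrite mulrBl mul1r -exprMn mulVf// expr1n.
rewrite -e -[X in _ ^+ X]card_ord -prodr_const -big_split/=.
by apply: eq_bigr => i _; rewrite !hornerE mulrBl mulVf.
Qed.

Lemma prod_1sub_prim_root_mul (F : fieldType) (n m : nat) (z y : F) : n.-primitive_root z ->
  \prod_(i < m * n) (1 - z ^+ i * y) = (1 - y ^+ n) ^+ m.
Proof.
move=> zn; elim: m => [|m IH]; first by rewrite mul0n big_ord0 expr0.
rewrite mulSn big_split_ord/= exprS prod_1sub_prim_root//; congr (_ * _).
by rewrite -IH; apply: eq_bigr => i _; rewrite exprD prim_expr_order// mul1r.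
Qed.

(** The default value 1 off the units is the one built into [unit_order], which is thus the order of
    a [zunit]. *)
Definition zunit (q : nat) (x : 'Z_q) : {unit 'Z_q} := insubd (1%g : {unit 'Z_q}) x.

Lemma val_zunit q (x : 'Z_q) : x \is a GRing.unit -> val (zunit x) = x.
Proof. by move=> xu; rewrite /zunit val_insubd xu. Qed.

Section characters.
Variables (R : realType) (q : nat) (q_gt1 : (1 < q)%N).
Implicit Types chi : {ffun 'Z_q -> R[i]}.

Lemma dirichlet_characterX chi x n : dirichlet_character chi -> chi (x ^+ n) = chi x ^+ n.
Proof.
by case=> chi1 chiM _; elim: n => [|n IH]; rewrite ?expr0// !exprS chiM IH.
Qed.

Lemma dirichlet_character_unit_order chi x : dirichlet_character chi ->
  x \is a GRing.unit -> chi x ^+ totient q = 1.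
Proof.
move=> chiD xu; rewrite -dirichlet_characterX//.
have -> : x ^+ totient q = val (zunit x ^+ totient q)%g.
  by rewrite /= FinRing.val_unitX val_zunit.
rewrite -card_units_Zp ?(ltnW q_gt1)// expg_cardG ?inE//= .
by case: chiD.
Qed.

Lemma dirichlet_character_norm_le1 chi x : dirichlet_character chi -> `|chi x| <= 1.
Proof.
move=> chiD; case: (boolP (x \is a GRing.unit)) => xu; last first.
  by case: chiD => _ _ ->//; rewrite normr0.
have T0 : (0 < totient q)%N by rewrite totient_gt0 ltnW.
suff /eqP -> : `|chi x| == 1 by [].
by rewrite -(pexpr_eq1 T0)// -normrX dirichlet_character_unit_order// normr1.
Qed.

Lemma dirichlet_character_conj chi : dirichlet_character chi ->
  dirichlet_character ([ffun x => (chi x)^*%C]).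
Proof.
case=> chi1 chiM chi0; split; first by rewrite ffunE chi1 conjc1.
  by move=> x y; rewrite !ffunE chiM rmorphM.
by move=> x xu; rewrite ffunE chi0// conjc0.
Qed.

Lemma dirichlet_character_sum0 chi : dirichlet_character chi ->
  chi != principal_character R q -> \sum_(0 <= k < q) chi k%:R = 0.
Proof.
move=> [chi1 chiM chi0] chiN.
have [u uu chiu] : exists2 u, u \is a GRing.unit & chi u != 1.
  have [[u [uu chiu]]|H] := pselect (exists u, u \is a GRing.unit /\ chi u != 1).
    by exists u.
  exfalso; move/eqP : chiN; apply; apply/ffunP => x; rewrite ffunE.
  case: ifPn => xu; last exact: chi0.
  by apply/eqP; apply: contrapT => /negP chix; apply: H; exists x.
have -> : \sum_(0 <= k < q) chi k%:R = \sum_(x : 'Z_q) chi x.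
  rewrite -{1}(Zp_cast q_gt1) big_mkord; apply: eq_bigr => i _.
  by rewrite natr_Zp.
apply: (mulfI (_ : chi u - 1 != 0)); first by rewrite subr_eq0.
rewrite mulr0 mulrBl mul1r mulr_sumr.
rewrite [X in _ - X](reindex_inj (mulrI uu)).
by rewrite /= -sumrB big1// => x _; rewrite chiM subrr.
Qed.

Lemma dirichlet_character_partial_sum chi : dirichlet_character chi ->
  chi != principal_character R q ->
  forall n, `|\sum_(1 <= k < n) chi k%:R| <= q%:R.
Proof.
move=> chiD chiN; have [chi1 chiM chi0] := chiD.
have chi00 : chi 0%:R = 0 by rewrite chi0// unitr0.
have per k : chi (k + q)%:R = chi k%:R by rewrite natrD pchar_Zp// addr0.
have S0 := dirichlet_character_sum0 chiD chiN.
have shift n : \sum_(0 <= k < n + q) chi k%:R = \sum_(0 <= k < n) chi k%:R.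
  rewrite addnC (@big_cat_nat _ _ _ q) ?leq_addr//= S0 add0r -{1}[q]add0n big_addn addKn.
  by apply: eq_bigr => i _; rewrite per.
have shiftm a r : \sum_(0 <= k < a * q + r) chi k%:R = \sum_(0 <= k < r) chi k%:R.
  elim: a => [|a IH]; first by rewrite mul0n add0n.
  by rewrite mulSn -addnA addnC shift.
move=> n.
have -> : \sum_(1 <= k < n) chi k%:R = \sum_(0 <= k < n) chi k%:R.
  by case: n => [|n]; [rewrite !big_geq|rewrite [RHS]big_ltn// chi00 add0r].
rewrite (divn_eq n q) shiftm.
apply: le_trans (ler_norm_sum _ _ _) _.
apply: le_trans (_ : \sum_(0 <= k < n %% q) (1 : R[i]) <= _).
  by apply: ler_sum => i _; exact: dirichlet_character_norm_le1.
by rewrite sumr_const_nat subn0 ler_nat ltnW// ltn_mod ltnW.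
Qed.

Hypothesis q_cyc : cyclic (units_Zp q).

(** For a generator g and a primitive root of unity z of order T = phi(q), the characters are g^i ->
    z^(i j) with 0 <= j < T. The principal one is j = 0; it is left out of the list and accounts for
    the factor 1 - y. If p = g^k, the product runs over the powers of z^k, a primitive root of order
    T / gcd(k, T), which is the order of p, and each of its powers occurs gcd(k, T) times. *)
Lemma cyclic_characters : exists chs : seq {ffun 'Z_q -> R[i]},
  [/\ uniq chs,
   forall chi, (chi \in chs) = `[< dirichlet_character chi /\ chi != principal_character R q >] &
   forall (p : nat) (y : R[i]), coprime q p ->
     (1 - y) * \prod_(chi <- chs) (1 - chi p%:R * y) =
     (1 - y ^+ unit_order q p) ^+ (totient q %/ unit_order q p)].
Proof.
have /cyclicP[g Gg] := q_cyc.
set T := totient q.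
have T0 : (0 < T)%N by rewrite totient_gt0 ltnW.
have og : #[g]%g = T by rewrite orderE -Gg card_units_Zp// ltnW.
have [z zT] := @prim_root_exists R[i] T T0.
have dl (u : {unit 'Z_q}) : exists i, u == (g ^+ i)%g.
  have : u \in <[g]>%g by rewrite -Gg inE.
  by move=> /cycleP[i ->]; exists i.
pose dlog u := xchoose (dl u).
have dlogE u : (g ^+ dlog u)%g = u by apply/esym/eqP; exact: (xchooseP (dl u)).
have dlogX i : dlog (g ^+ i)%g = i %[mod T].
  by apply/eqP; rewrite -og -eq_expg_mod_order dlogE.
pose ch (j : nat) : {ffun 'Z_q -> R[i]} :=
  [ffun x => if x \is a GRing.unit then (z ^+ j) ^+ dlog (zunit x) else 0].
have zj j : (z ^+ j) ^+ T = 1 by rewrite exprAC (prim_expr_order zT) expr1n.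
have zmod j a b : a = b %[mod T] -> (z ^+ j) ^+ a = (z ^+ j) ^+ b.
  by move=> ab; rewrite -(expr_mod a (zj j)) ab expr_mod.
have gu i : val (g ^+ i)%g \is a (@GRing.unit 'Z_q) by exact: valP.
have zunitK (u : {unit 'Z_q}) : zunit (val u) = u by rewrite /zunit valKd.
have chg j i : ch j (val (g ^+ i)%g) = (z ^+ j) ^+ i.
  by rewrite ffunE gu zunitK; apply: zmod.
have unitg x : x \is a GRing.unit -> exists i, x = val (g ^+ i)%g.
  by move=> xu; exists (dlog (zunit x)); rewrite dlogE val_zunit.
have chD j : dirichlet_character (ch j).
  split.
  - by have := chg j 0; rewrite expg0 expr0.
  - move=> x y; case: (boolP (x * y \is a GRing.unit)) => xyu.
      move: (xyu); rewrite unitrM => /andP[/unitg[i ->] /unitg[k ->]].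
      have -> : val (g ^+ i)%g * val (g ^+ k)%g = val (g ^+ (i + k))%g :> 'Z_q.
        by rewrite expgD.
      by rewrite !chg exprD.
    rewrite {1}/ch ffunE (negbTE xyu); apply/esym/eqP; rewrite mulf_eq0.
    move: xyu; rewrite unitrM negb_and => /orP[] /negbTE h.
      by rewrite {1}/ch ffunE h eqxx.
    by rewrite {2}/ch [X in _ || (X == _)]ffunE h eqxx orbT.
  - by move=> x /negbTE xu; rewrite ffunE xu.
have ch0 : ch 0 = principal_character R q.
  by apply/ffunP => x; rewrite !ffunE expr0 expr1n.
have ch_inj i j : (i < T)%N -> (j < T)%N -> ch i = ch j -> i = j.
  move=> iT jT /ffunP/(_ (val g)); have := chg i 1; have := chg j 1.
  rewrite !expg1 !expr1 => -> -> /eqP; rewrite (eq_prim_root_expr zT) !modn_small// => /eqP.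
  by [].
have chall chi : dirichlet_character chi -> exists2 j, (j < T)%N & chi = ch j.
  move=> chiD.
  have := dirichlet_character_unit_order chiD (valP g).
  move/(prim_rootP zT) => [j chij]; exists j => //.
  apply/ffunP => x; case: (boolP (x \is a GRing.unit)) => xu; last first.
    by rewrite ffunE (negbTE xu); case: chiD => _ _ ->.
  have [i ->] := unitg _ xu; rewrite chg.
  by rewrite FinRing.val_unitX dirichlet_characterX// chij.
exists [seq ch j | j <- index_iota 1 T]; split.
- rewrite map_inj_in_uniq ?iota_uniq// => i j.
  by rewrite !mem_index_iota => /andP[_ iT] /andP[_ jT]; exact: ch_inj.
- move=> chi; apply/mapP/asboolP => [[j]|[chiD chiN]].
    rewrite mem_index_iota => /andP[j1 jT] ->; split; first exact: chD.
    by rewrite -ch0; apply/eqP => /(ch_inj _ _ jT T0) j0; rewrite j0 in j1.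
  have [j jT e] := chall _ chiD; exists j => //.
  rewrite mem_index_iota jT andbT lt0n; apply: contra chiN => /eqP j0.
  by rewrite e j0 ch0.
- move=> p y qp.
  have pu : (p%:R : 'Z_q) \is a GRing.unit by rewrite unitZpE.
  have [k pk] := unitg _ pu.
  have -> : unit_order q p = (T %/ gcdn k T)%N.
    by rewrite /unit_order pk -/(zunit _) zunitK orderXgcd og gcdnC.
  have -> : (1 - y) * \prod_(chi <- [seq ch j | j <- index_iota 1 T]) (1 - chi p%:R * y) =
      \prod_(i < T) (1 - (z ^+ k) ^+ i * y).
    rewrite big_map -(big_mkord predT (fun i => 1 - (z ^+ k) ^+ i * y)) [RHS]big_ltn//.
    rewrite expr0 mul1r; congr (_ * _); apply: eq_bigr => i _.
    by rewrite pk chg exprAC.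
  have zk := exp_prim_root zT k.
  set n := (T %/ gcdn k T)%N in zk *.
  have nT : (n %| T)%N by rewrite /n dvdn_divLR ?dvdn_gcdr ?gcdn_gt0 ?T0 ?orbT// dvdn_mulr.
  by rewrite -(prod_1sub_prim_root_mul _ _ zk) divnK.
Qed.

End characters.

(** * L-functions of characters *)

Section complex_limits.
Variable R : realType.

Lemma normc_real (x : R) : `|x%:C| = `|x|%:C.
Proof. by rewrite normc_def/= expr0n/= addr0 sqrtr_sqr. Qed.

Lemma normc_le_ReIm (z : R[i]) : `|z| <= (`|complex.Re z| + `|complex.Im z|)%:C.
Proof.
rewrite {1}[z]complexE; apply: le_trans (ler_normD _ _) _.
rewrite normrM !normc_real rmorphD lerD//.
have -> : `|'i%C| = 1 :> R[i] by rewrite normc_def/= expr0n/= add0r expr1n sqrtr1.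
by rewrite mul1r.
Qed.

Lemma normc_ge_Im (z : R[i]) : `|complex.Im z|%:C <= `|z|.
Proof.
have := normc_ge_Re (z * 'i%C); rewrite ReiNIm normrN normrM.
have -> : `|'i%C| = 1 :> R[i] by rewrite normc_def/= expr0n/= add0r expr1n sqrtr1.
by rewrite mulr1.
Qed.

(** The order of [R[i]] relates only numbers with equal imaginary parts, so every epsilon in a
    complex limit is real. *)
Lemma posc_real (e : R[i]) : 0 < e -> 0 < complex.Re e /\ e = (complex.Re e)%:C.
Proof. by case: e => a b; rewrite ltcE/= => /andP[/eqP -> ?]. Qed.

Lemma cvg_complex (T : Type) (F : set_system T) (FF : Filter F) (u : T -> R[i]) (a b : R) :
  complex.Re (u x) @[x --> F] --> a -> complex.Im (u x) @[x --> F] --> b ->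
  (u x : (R[i])^o) @[x --> F] --> ((a +i* b) : (R[i])^o).
Proof.
move=> /cvgrPdist_le ua /cvgrPdist_le ub; apply/cvgrPdist_le => e e0.
have [e0' ->] := posc_real e0.
have e2 : 0 < complex.Re e / 2 by rewrite divr_gt0.
near=> x.
have h1 : `|a - complex.Re (u x)| <= complex.Re e / 2 by near: x; exact: ua.
have h2 : `|b - complex.Im (u x)| <= complex.Re e / 2 by near: x; exact: ub.
apply: le_trans (normc_le_ReIm _) _; rewrite lecR [leRHS]splitr.
by move: h1 h2; case: (u x) => c d /= h1 h2; rewrite lerD.
Unshelve. all: by end_near.
Qed.

Lemma cvg_Re (T : Type) (F : set_system T) (FF : Filter F) (u : T -> R[i]) (l : R[i]) :
  (u x : (R[i])^o) @[x --> F] --> (l : (R[i])^o) -> complex.Re (u x) @[x --> F] --> complex.Re l.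
Proof.
move=> /cvgrPdist_le ul; apply/cvgrPdist_le => e e0.
have eC : 0 < e%:C by rewrite ltcR.
near=> x.
have h : `|l - u x| <= e%:C by near: x; exact: ul.
rewrite -lecR; apply: le_trans h.
by apply: le_trans (normc_ge_Re _); case: (u x) => a b; case: (l).
Unshelve. all: by end_near.
Qed.

Lemma cvg_real_complex (T : Type) (F : set_system T) (FF : Filter F) (u : T -> R) (l : R) :
  u x @[x --> F] --> l -> ((u x)%:C : (R[i])^o) @[x --> F] --> (l%:C : (R[i])^o).
Proof. by move=> ul; apply: cvg_complex => //; exact: cvg_cst. Qed.

End complex_limits.

Section dirichlet_L.
Variables (R : realType) (q : nat) (q_gt1 : (1 < q)%N) (chi : {ffun 'Z_q -> R[i]}).
Hypothesis chiD : dirichlet_character chi.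
Hypothesis chiN : chi != principal_character R q.

(** The Dirichlet test above is over the reals; real and imaginary parts of a character inherit its
    bound [q] on partial sums. *)
Let bRe n := complex.Re (chi n%:R).
Let bIm n := complex.Im (chi n%:R).

Let Re_sum (I : Type) (r : seq I) (F : I -> R[i]) : complex.Re (\sum_(i <- r) F i) = \sum_(i <- r) complex.Re (F i).
Proof. by elim/big_rec2: _ => // i x y _ <-; case: (F i) y => a b []. Qed.

Let Im_sum (I : Type) (r : seq I) (F : I -> R[i]) : complex.Im (\sum_(i <- r) F i) = \sum_(i <- r) complex.Im (F i).
Proof. by elim/big_rec2: _ => // i x y _ <-; case: (F i) y => a b []. Qed.

Let bRe_bound n : `|\sum_(1 <= k < n) bRe k| <= q%:R.
Proof.
have := dirichlet_character_partial_sum q_gt1 chiD chiN n.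
rewrite -Re_sum => h; rewrite -lecR; apply: le_trans (normc_ge_Re _) _.
by rewrite rmorph_nat.
Qed.

Let bIm_bound n : `|\sum_(1 <= k < n) bIm k| <= q%:R.
Proof.
have := dirichlet_character_partial_sum q_gt1 chiD chiN n.
rewrite -Im_sum => h; rewrite -lecR; apply: le_trans (normc_ge_Im _) _.
by rewrite rmorph_nat.
Qed.

Let L_re s := limn (fun N => \sum_(1 <= n < N) bRe n * n%:R `^ (- s)).
Let L_im s := limn (fun N => \sum_(1 <= n < N) bIm n * n%:R `^ (- s)).

Lemma dirichletL_partial_cvg s : 0 < s ->
  (fun N => \sum_(1 <= n < N) chi n%:R * (n%:R `^ (- s))%:C : (R[i])^o) @ \oo -->
    ((L_re s +i* L_im s) : (R[i])^o).
Proof.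
move=> s0; apply: cvg_complex.
  have := dirichlet_series_cvg bRe_bound s0; apply: cvg_trans; apply: near_eq_cvg.
  near=> N; rewrite Re_sum; apply: eq_bigr => i _.
  by rewrite /bRe; case: (chi _) => a b /=; rewrite mulr0 subr0.
have := dirichlet_series_cvg bIm_bound s0; apply: cvg_trans; apply: near_eq_cvg.
near=> N; rewrite Im_sum; apply: eq_bigr => i _.
by rewrite /bIm; case: (chi _) => a b /=; rewrite mulr0 add0r.
Unshelve. all: by end_near.
Qed.

Lemma dirichletLE s : 0 < s -> dirichletL s chi = L_re s +i* L_im s.
Proof.
move=> s0; apply: (@cvg_lim ((R[i])^o : normedModType R[i])).
  exact: norm_hausdorff.
exact: dirichletL_partial_cvg.
Qed.

Lemma dirichletL_cvg s : 0 < s ->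
  (fun N => \sum_(1 <= n < N) chi n%:R * (n%:R `^ (- s))%:C : (R[i])^o) @ \oo -->
    (dirichletL s chi : (R[i])^o).
Proof. by move=> s0; rewrite dirichletLE//; exact: dirichletL_partial_cvg. Qed.

Lemma dirichletL_lipschitz d : 0 < d ->
  `|dirichletL (1 + d) chi - dirichletL 1 chi| <= (6 * q%:R * d)%:C.
Proof.
move=> d0; rewrite !dirichletLE ?addr_gt0//.
apply: le_trans (normc_le_ReIm _) _; rewrite lecR/=.
have := dirichlet_series_lipschitz bRe_bound d0.
have := dirichlet_series_lipschitz bIm_bound d0.
rewrite /L_re /L_im; lra.
Qed.

Lemma dirichletL_at1 :
  (dirichletL (1 + d) chi : (R[i])^o) @[d --> (0 : R)^'+] --> (dirichletL 1 chi : (R[i])^o).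
Proof.
apply/cvgrPdist_le => e e0; have [e0' ->] := posc_real e0.
have q0 : 0 < 6 * (q%:R : R) by rewrite mulr_gt0// ltr0n ltnW.
near=> d; have d0 : 0 < d by near: d; exact: nbhs_right_gt.
rewrite distrC; apply: le_trans (dirichletL_lipschitz d0) _; rewrite lecR.
rewrite mulrC -ler_pdivlMr//; near: d; apply: nbhs_right_le.
by rewrite divr_gt0.
Unshelve. all: by end_near.
Qed.

Lemma dirichletL_conj :
  dirichletL 1 ([ffun x => (chi x)^*%C] : {ffun 'Z_q -> R[i]}) = (dirichletL 1 chi)^*%C.
Proof.
apply: (@cvg_lim ((R[i])^o : normedModType R[i])); first exact: norm_hausdorff.
rewrite dirichletLE//=; apply: cvg_complex.
  have := dirichlet_series_cvg bRe_bound ltr01; apply: cvg_trans; apply: near_eq_cvg.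
  near=> N; rewrite Re_sum; apply: eq_bigr => i _.
  by rewrite ffunE /bRe; case: (chi _) => a b /=; rewrite mulr0 subr0.
have cI := cvgN (dirichlet_series_cvg bIm_bound ltr01).
apply: cvg_trans; last exact: cI.
apply: near_eq_cvg.
near=> N; rewrite Im_sum fctE -sumrN; apply: eq_bigr => i _.
by rewrite ffunE /bIm; case: (chi _) => a b /=; rewrite mulr0 add0r mulNr.
Unshelve. all: by end_near.
Qed.

Lemma dirichletL_real_neq0 : (forall x, complex.Im (chi x) = 0) -> dirichletL 1 chi != 0.
Proof.
move=> chi_im; rewrite dirichletLE//; apply/eqP => -[L0 _].
suff : L_re 1 != 0 by rewrite L0 eqxx.
have [chi1 chiM chi0] := chiD.
have chiE x : chi x = (complex.Re (chi x))%:C by rewrite [LHS]complexE chi_im mulr0 addr0.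
have T0 : (0 < totient q)%N by rewrite totient_gt0 ltnW.
apply: (@real_character_L1_neq0 R bRe q%:R) => //.
- by rewrite /bRe chi1.
- move=> m n; rewrite /bRe natrM chiM chiE [chi n%:R]chiE.
  by rewrite -rmorphM.
- move=> n; rewrite /bRe; case: (boolP ((n%:R : 'Z_q) \is a GRing.unit)) => nu; last first.
    by rewrite chi0// eqxx.
  have := dirichlet_character_unit_order q_gt1 chiD nu; rewrite chiE -rmorphXn /= => -[h].
  have : `|complex.Re (chi n%:R)| ^+ totient q == 1 by rewrite -normrX h normr1.
  rewrite pexpr_eq1// eqr_norml ler01 andbT => /orP[] ->.
    by rewrite orbT.
  by rewrite !orbT.
Qed.

Lemma dirichletL_euler s : 1 < s ->
  (fun N => dirichletL s chi * \prod_(0 <= p < N | prime p) (1 - chi p%:R * (p%:R `^ (- s))%:C)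
    : (R[i])^o) @ \oo --> (1 : (R[i])^o).
Proof.
move=> s1; have s0 : 0 < s by rewrite (lt_trans _ s1).
have [chi1 chiM chi0] := chiD.
pose g n : R := n%:R `^ (- s).
apply: (@euler_product_cvg _ (fun n => chi n%:R * (g n)%:C) _ _ _ (fun N => (zeta_tail s N)%:C)).
- move=> m n; rewrite natrM chiM /g natrM powRM ?ler0n// rmorphM.
  by rewrite mulrACA.
- exact: dirichletL_cvg.
- by rewrite /g chi1 powR1 mul1r.
- move=> N M.
  apply: le_trans (_ : (\sum_(N <= n < M) g n)%:C <= _); last by rewrite lecR zeta_tail_ge.
  rewrite rmorph_sum /=; apply: ler_sum => n _.
  rewrite normrM normc_real (ger0_norm (powR_ge0 _ _)) ler_piMl// ?ler0c ?powR_ge0//.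
  exact: dirichlet_character_norm_le1.
- by apply: cvg_real_complex; exact: zeta_tail_cvg.
Qed.

End dirichlet_L.

Lemma zeta_euler (R : realType) (s : R) : 1 < s ->
  (fun N => zeta s * \prod_(0 <= p < N | prime p) (1 - (p%:R `^ (- s)))) @ \oo --> (1 : R).
Proof.
move=> s1; apply: (@euler_product_cvg R (fun n => n%:R `^ (- s)) (zeta s) _ _ (zeta_tail s)).
- by move=> m n; rewrite natrM powRM ?ler0n.
- exact: zeta_cvg.
- by rewrite powR1.
- move=> N M; under eq_bigr do rewrite (ger0_norm (powR_ge0 _ _)).
  exact: zeta_tail_ge.
- exact: zeta_tail_cvg.
Qed.

Lemma unit_order_gt0 q p : (0 < unit_order q p)%N.
Proof. exact: order_gt0. Qed.

Lemma powRN_prime_lt1 (R : realType) (p : nat) (s : R) : prime p -> 0 < s ->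
  0 < (p%:R : R) `^ (- s) < 1.
Proof.
move=> pp s0; rewrite powR_gt0 ?ltr0n ?prime_gt0//=.
by rewrite powR_natE ?prime_gt0// expR_lt1 mulNr oppr_lt0 mulr_gt0// ln_gt0// ltr1n prime_gt1.
Qed.

Lemma subr1X_itv (R : realType) (x : R) n m : 0 < x < 1 -> (0 < n)%N ->
  0 < (1 - x ^+ n) ^+ m <= 1.
Proof.
move=> /andP[x0 x1] n0.
have xn : 0 < x ^+ n < 1 by rewrite exprn_gt0//= exprn_ilt1 ?(ltW x0)// -lt0n.
have a : 0 < 1 - x ^+ n by lra.
have b : 1 - x ^+ n <= 1 by lra.
by rewrite exprn_gt0//= exprn_ile1// ltW.
Qed.

Lemma prod_primes_totient (R : realType) (q : nat) : (0 < q)%N ->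
  \prod_(p <- primes q) (1 - (p%:R : R) `^ (- 1)) = (totient q)%:R / q%:R.
Proof.
move=> q0; rewrite totientE// natr_prod.
have -> : (q%:R : R) = \prod_(p <- primes q) (p ^ logn p q)%:R.
  by rewrite {1}(prod_prime_decomp q0) prime_decompE big_map/= natr_prod.
rewrite -prodfV -big_split /=; apply: eq_big_seq => p.
rewrite mem_primes => /and3P[pp _ pq].
have l0 : (0 < logn p q)%N by rewrite logn_gt0 mem_primes pp q0 pq.
have p0 : (p%:R : R) != 0 by rewrite pnatr_eq0 -lt0n prime_gt0.
rewrite -{2}(prednK l0) expnS !natrM invfM.
set x := (p ^ _)%:R; have x0 : x != 0 by rewrite /x pnatr_eq0 -lt0n expn_gt0 prime_gt0.
rewrite mulrACA divff// mulr1 powR_inv1// -subn1 natrB ?prime_gt0//.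
by rewrite mulrBl divff// mul1r.
Qed.

Section euler_factor.
Variables (R : realType) (q : nat).

Definition local_factor (s : R) (p : nat) : R :=
  (1 - (p%:R `^ (- s)) ^+ unit_order q p) ^+ (totient q %/ unit_order q p).

(** It turns zeta into the L-function of the principal character. *)
Definition ramified_factor (s : R) : R := \prod_(p <- primes q) (1 - p%:R `^ (- s)).

Lemma local_factor_itv s p : prime p -> 0 < s -> 0 < local_factor s p <= 1.
Proof.
by move=> pp s0; rewrite subr1X_itv ?powRN_prime_lt1// unit_order_gt0.
Qed.

Lemma ramified_factor_itv s : 0 < s -> 0 <= ramified_factor s <= 1.
Proof.
move=> s0; rewrite /ramified_factor; apply/andP; split.
  rewrite big_seq prodr_ge0// => p; rewrite mem_primes => /and3P[pp _ _].
  by have := powRN_prime_lt1 pp s0; lra.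
rewrite big_seq prodr_ile1// => p; rewrite mem_primes => /and3P[pp _ _].
by have := powRN_prime_lt1 pp s0; lra.
Qed.

Lemma cvg_powRN_1D (p : nat) : (0 < p)%N ->
  (p%:R : R) `^ (- (1 + d)) @[d --> (0 : R)^'+] --> (p%:R : R) `^ (- 1).
Proof.
move=> p0.
have c1 : - (1 + d) * ln p%:R @[d --> (0 : R)^'+] --> - 1 * ln (p%:R : R).
  apply: cvgMr_tmp; apply: cvgN; apply: cvg_to_eq.
    by apply: cvgD; [exact: cvg_cst|exact: cvg_id_right0].
  by rewrite addr0.
have c2 := cvg_comp _ _ c1 (@continuous_expR R _).
rewrite powR_natE//; under eq_fun do rewrite powR_natE//.
exact: c2.
Qed.

Lemma ramified_factor_cvg : (0 < q)%N ->
  ramified_factor (1 + d) @[d --> (0 : R)^'+] --> (totient q)%:R / (q%:R : R).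
Proof.
move=> q0; rewrite -prod_primes_totient// /ramified_factor big_seq.
under eq_fun do rewrite big_seq.
apply: (cvg_big mul_continuous) => p; rewrite mem_primes => /and3P[pp _ _].
by apply: cvgB; [exact: cvg_cst|exact/cvg_powRN_1D/prime_gt0].
Qed.

Lemma ramified_factorE s N : (0 < q)%N -> (q < N)%N ->
  \prod_(0 <= p < N | prime p && ~~ coprime q p) (1 - (p%:R : R) `^ (- s)) = ramified_factor s.
Proof.
move=> q0 qN; rewrite -big_filter; apply: perm_big; apply: uniq_perm.
- by rewrite filter_uniq// iota_uniq.
- exact: primes_uniq.
move=> p; rewrite mem_filter mem_index_iota mem_primes q0 /=.
case: (boolP (prime p)) => //= pp; rewrite coprime_sym prime_coprime// negbK.
by case: (boolP (p %| q)%N) => //= pq; rewrite (leq_ltn_trans (dvdn_leq q0 pq)).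
Qed.

End euler_factor.

(** * The product of all L-functions for s > 1 *)

Section product_of_L.
Variables (R : realType) (q : nat) (q_gt1 : (1 < q)%N).
Variable chs : seq {ffun 'Z_q -> R[i]}.
Hypothesis chs_uniq : uniq chs.
Hypothesis chsP : forall chi, (chi \in chs) =
  `[< dirichlet_character chi /\ chi != principal_character R q >].
Hypothesis chs_prod : forall (p : nat) (y : R[i]), coprime q p ->
     (1 - y) * \prod_(chi <- chs) (1 - chi p%:R * y) =
     (1 - y ^+ unit_order q p) ^+ (totient q %/ unit_order q p).

Let chsD chi : chi \in chs -> dirichlet_character chi.
Proof. by rewrite chsP => /asboolP[]. Qed.

Let chsN chi : chi \in chs -> chi != principal_character R q.
Proof. by rewrite chsP => /asboolP[]. Qed.

Let q0 : (0 < q)%N. Proof. exact: ltnW. Qed.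

(** At primes dividing q all characters vanish, so only the factor of zeta is left, and
    [ramified_factor] accounts for it. At the others [chs_prod] combines the factors. *)
Lemma product_of_L_euler s : 1 < s ->
  (fun N => (zeta s * ramified_factor q s)%:C * \prod_(chi <- chs) dirichletL s chi *
    (\prod_(0 <= p < N | prime p && coprime q p) local_factor q s p)%:C : (R[i])^o) @ \oo -->
  (1 : (R[i])^o).
Proof.
move=> s1.
have c1 := cvg_real_complex _ (zeta_euler s1).
have c2 : (fun N => \prod_(chi <- chs) (dirichletL s chi *
    \prod_(0 <= p < N | prime p) (1 - chi p%:R * (p%:R `^ (- s))%:C)) : (R[i])^o) @ \oo -->
    (1 : (R[i])^o).
  apply: (@cvg_to_eq _ ((R[i])^o) _ _ (\prod_(chi <- chs | chi \in chs) 1)); last by rewrite big1.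
  under eq_fun do rewrite big_seq.
  apply: (@cvg_big ((R[i])^o) _ _ _ _ (@mul_continuous R[i])) => chi chich.
  by apply: dirichletL_euler => //; [exact: chsD|exact: chsN].
have c3 : (fun N => (zeta s * \prod_(0 <= p < N | prime p) (1 - (p%:R : R) `^ (- s)))%:C *
    \prod_(chi <- chs) (dirichletL s chi *
      \prod_(0 <= p < N | prime p) (1 - chi p%:R * (p%:R `^ (- s))%:C)) : (R[i])^o) @ \oo -->
    (1 : (R[i])^o).
  by apply: cvg_to_eq; [exact: (cvgM (c1 _) c2)|rewrite mulr1].
apply: cvg_trans c3; apply: near_eq_cvg; near=> N.
have qN : (q < N)%N by near: N; exact: nbhs_infty_gt.
have key : (\prod_(0 <= p < N | prime p) (1 - (p%:R : R) `^ (- s)))%:C *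
    \prod_(0 <= p < N | prime p) \prod_(chi <- chs) (1 - chi p%:R * (p%:R `^ (- s))%:C) =
    (ramified_factor q s)%:C *
      (\prod_(0 <= p < N | prime p && coprime q p) local_factor q s p)%:C.
  rewrite rmorph_prod -big_split (bigID (coprime q))/= mulrC; congr (_ * _).
    rewrite -(ramified_factorE s q0 qN) rmorph_prod; apply: eq_bigr => p /andP[pp qp].
    rewrite [X in _ * X]big1_seq ?mulr1// => chi /andP[_ /chsD [_ _ chi0]].
    by rewrite chi0 ?mul0r ?subr0// unitZpE.
  rewrite rmorph_prod; apply: eq_bigr => p /andP[pp qp].
  rewrite rmorphB rmorph1 chs_prod// /local_factor rmorphXn rmorphB rmorph1 rmorphXn.
  by [].
rewrite big_split/= exchange_big/= !rmorphM -!mulrA; congr (_ * _).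
by rewrite [LHS]mulrCA key [LHS]mulrCA.
Unshelve. all: by end_near.
Qed.

(** The partial products of [local_factor] decrease in [0,1], hence converge. Their limit times the
    complex product of L-values is 1, so the limit is nonzero and its inverse, a real number at
    least 1, is that product. *)
Lemma product_of_L_real s : 1 < s -> exists D : R,
  [/\ 1 <= D, (zeta s * ramified_factor q s)%:C * \prod_(chi <- chs) dirichletL s chi = D%:C &
  (fun N => \prod_(0 <= p < N | prime p && coprime q p) local_factor q s p) @ \oo --> D^-1].
Proof.
move=> s1; have s0 : 0 < s by rewrite (lt_trans _ s1).
pose r N := \prod_(0 <= p < N | prime p && coprime q p) local_factor q s p.
have rP N : 0 <= r N <= 1.
  apply/andP; split; [apply: prodr_ge0|apply: prodr_ile1] => p /andP[pp _];
    have /andP[/ltW] := local_factor_itv q pp s0; last by move=> -> ->.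
  by [].
have r_cvg : cvgn r.
  apply: nonincreasing_is_cvgn; last by exists 0 => _ [n _ <-]; case/andP: (rP n).
  apply/nonincreasing_seqP => n; rewrite /r big_mkcond big_nat_recr//= -big_mkcond.
  case: ifPn => [/andP[pp _]|_]; last by rewrite mulr1.
  have /andP[_ h] := local_factor_itv q pp s0.
  by rewrite ler_piMr//; case/andP: (rP n).
have rho1 : limn r <= 1.
  by apply: (cvgr_to_le r_cvg); near=> n; case/andP: (rP n).
have rho0 : 0 <= limn r.
  by apply: (cvgr_to_ge r_cvg); near=> n; case/andP: (rP n).
set D := (_ * _)%:C * \prod_(chi <- chs) _.
have c1 := product_of_L_euler s1.
have c2 := @cvgMl_tmp R[i] _ _ _ _ D _ (cvg_real_complex _ r_cvg).
have e : D * (limn r)%:C = 1.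
  exact: (@cvg_unique _ (@norm_hausdorff _ ((R[i])^o : normedModType R[i])) _ _ _ _ (c2 _ _) c1).
have rhon0 : limn r != 0.
  by apply/eqP => h; move: e; rewrite h rmorph0 mulr0 => /eqP; rewrite eq_sym oner_eq0.
have rhop : 0 < limn r by rewrite lt_neqAle eq_sym rhon0.
exists (limn r)^-1; split; last by rewrite invrK.
  by rewrite invf_ge1.
rewrite fmorphV; apply: (@mulIf _ (limn r)%:C).
  by rewrite fmorph_eq0.
by rewrite e mulVf// fmorph_eq0.
Unshelve. all: by end_near.
Qed.
End product_of_L.

(** * Nonvanishing at 1 for all characters *)

Section nonvanishing.
Variables (R : realType) (q : nat) (q_gt1 : (1 < q)%N).
Variable chs : seq {ffun 'Z_q -> R[i]}.
Hypothesis chs_uniq : uniq chs.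
Hypothesis chsP : forall chi, (chi \in chs) =
  `[< dirichlet_character chi /\ chi != principal_character R q >].
Hypothesis chs_prod : forall (p : nat) (y : R[i]), coprime q p ->
     (1 - y) * \prod_(chi <- chs) (1 - chi p%:R * y) =
     (1 - y ^+ unit_order q p) ^+ (totient q %/ unit_order q p).

Let chsD chi : chi \in chs -> dirichlet_character chi.
Proof. by rewrite chsP => /asboolP[]. Qed.

Let chsN chi : chi \in chs -> chi != principal_character R q.
Proof. by rewrite chsP => /asboolP[]. Qed.

(* A non-real character vanishes at 1 together with its conjugate; the double
   zero beats the simple pole of zeta and contradicts 1 <= D. *)
Lemma dirichletL_neq0 chi : chi \in chs -> dirichletL 1 chi != 0.
Proof.
move=> chich; apply/negP => /eqP L0.
have cD := chsD chich; have cN := chsN chich.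
pose chi' : {ffun 'Z_q -> R[i]} := [ffun x => (chi x)^*%C].
have [chi'E|chi'N] := eqVneq chi' chi.
  move/eqP : L0; apply/negP; apply: dirichletL_real_neq0 => // x.
  have := congr1 (fun f : {ffun 'Z_q -> R[i]} => complex.Im (f x)) chi'E.
  by rewrite ffunE; case: (chi x) => a b /=; lra.
have c'D := dirichlet_character_conj cD.
have c'N : chi' != principal_character R q.
  apply: contra cN => /eqP/ffunP H; apply/eqP/ffunP => x.
  have := H x; rewrite !ffunE => /(congr1 (@conjc R)); rewrite conjcK => ->.
  by case: ifP => _; rewrite ?conjc0 ?conjc1.
have c'ch : chi' \in chs by rewrite chsP; apply/asboolP.
have L'0 : dirichletL 1 chi' = 0 by rewrite /chi' dirichletL_conj// L0 conjc0.
pose rest := rem chi' (rem chi chs).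
have c'ch' : chi' \in rem chi chs by rewrite mem_rem_uniq// !inE chi'N.
have rest_sub psi : psi \in rest -> psi \in chs.
  by move=> /mem_rem/mem_rem.
pose P d := \prod_(psi <- rest) `|dirichletL (1 + d) psi|.
(* This is (1 + 1/d) (6 q d)^2: zeta(1 + d) <= 1 + 1/d, and each of the two zeros gives a factor 6 q
   d by the Lipschitz bound. *)
have bound d : 0 < d -> 1 <= ((1 + d) * d * (6 * q%:R) ^+ 2)%:C * P d.
  move=> d0; have s1 : 1 < 1 + d by rewrite ltrDl.
  have [D [D1 DE _]] := product_of_L_real q_gt1 chsP chs_prod s1.
  have := congr1 Num.norm DE.
  rewrite normrM !normc_real normr_prod (big_rem _ chich)/= (big_rem _ c'ch')/= -/(P d) => DE'.
  have D1' : 1 <= `|D|%:C by rewrite lecR (le_trans D1)// ler_norm.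
  apply: le_trans D1' _; rewrite -DE'.
  have -> : ((1 + d) * d * (6 * q%:R) ^+ 2)%:C * P d =
    (1 + d^-1)%:C * ((6 * q%:R * d)%:C * ((6 * q%:R * d)%:C * P d)).
    rewrite !mulrA -!rmorphM; congr (_%:C * _).
    by field; rewrite gt_eqF.
  have L1 := dirichletL_lipschitz q_gt1 cD cN d0.
  have L2 := dirichletL_lipschitz q_gt1 c'D c'N d0.
  rewrite L0 subr0 in L1; rewrite L'0 subr0 in L2.
  have P0 : 0 <= P d by apply: prodr_ge0.
  rewrite ler_pM ?mulr_ge0//; last by rewrite ler_pM ?mulr_ge0// ler_wpM2r.
    by rewrite ler0c.
  rewrite lecR ger0_norm; last first.
    apply: mulr_ge0; first by apply: le_trans (zeta_ge d0); rewrite invr_ge0 ltW.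
    by have /andP[] := @ramified_factor_itv R q (1 + d) (addr_gt0 ltr01 d0).
  have /andP[r0 r1] := @ramified_factor_itv R q (1 + d) (addr_gt0 ltr01 d0).
  apply: le_trans (zeta_le d0); rewrite ler_piMr//.
  by apply: le_trans (zeta_ge d0); rewrite invr_ge0 ltW.
have Pc : (P d : (R[i])^o) @[d --> (0 : R)^'+] --> (\prod_(psi <- rest | psi \in rest) `|dirichletL 1 psi| : (R[i])^o).
  rewrite /P; under eq_fun do rewrite big_seq.
  apply: (@cvg_big ((R[i])^o) _ _ _ _ (@mul_continuous R[i])) => psi /rest_sub psich.
  exact: (cvg_norm (dirichletL_at1 q_gt1 (chsD psich) (chsN psich))).
have dc : (1 + d) * d * (6 * q%:R) ^+ 2 @[d --> (0 : R)^'+] --> (0 : R).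
  apply: cvg_to_eq.
    apply: cvgMr_tmp; apply: cvgM; last exact: cvg_id_right0.
    by apply: cvgD; [exact: cvg_cst|exact: cvg_id_right0].
  by rewrite mulr0 mul0r.
have dC := cvg_real_complex _ dc.
have Uc : (((1 + d) * d * (6 * q%:R) ^+ 2)%:C * P d : (R[i])^o) @[d --> (0 : R)^'+] --> (0 : (R[i])^o).
  by apply: cvg_to_eq; [exact: (cvgM (dC _) Pc)|rewrite mul0r].
have h2 : 0 < (2^-1 : R[i]) by rewrite invr_gt0.
move/cvgrPdist_le/(_ _ h2) : Uc => H.
have : (1 : R[i]) <= 2^-1.
  near (0 : R)^'+ => d.
  have d0 : 0 < d by near: d; exact: nbhs_right_gt.
  apply: le_trans (bound _ d0) _.
  have : `|0 - ((1 + d) * d * (6 * q%:R) ^+ 2)%:C * P d| <= 2^-1.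
    by near: d; exact: H.
  rewrite sub0r normrN; apply: le_trans; apply: real_ler_norm.
  rewrite realM ?complex_real//= realE; apply/orP; left; apply: prodr_ge0.
  by [].
by rewrite invf_ge1// lern1.
Unshelve. all: by end_near.
Qed.

End nonvanishing.

(** All that the sequel needs about L-functions, in real terms: the only complex number left is
    [Pi_q1]. *)
Theorem product_of_L_limit (R : realType) (q : nat) : (1 < q)%N -> cyclic (units_Zp q) ->
  exists (D : R -> R) (l : R),
  [/\ 0 < l,
     Pi_q1 R q = ((totient q)%:R / q%:R / l)%:C,
     forall s, 1 < s -> 0 < D s /\
       (fun N => \prod_(0 <= p < N | prime p && coprime q p) local_factor q s p) @ \oo --> (D s)^-1 &
     D (1 + d) * (1 - expR (- d)) @[d --> (0 : R)^'+] --> l].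
Proof.
move=> q_gt1 q_cyc.
have [chs [chs_uniq chsP chs_prod]] := cyclic_characters R q_gt1 q_cyc.
(* Choice is to make [D] a function on all of R; its values for s <= 1 carry no meaning. *)
have H s : exists D : R, 1 < s ->
  [/\ 1 <= D, (zeta s * ramified_factor q s)%:C * \prod_(chi <- chs) dirichletL s chi = D%:C &
  (fun N => \prod_(0 <= p < N | prime p && coprime q p) local_factor q s p) @ \oo --> D^-1].
  case: (ltP 1 s) => s1; last by exists 0.
  by have [D DP] := product_of_L_real q_gt1 chsP chs_prod s1; exists D.
have [D DP] := boolp.choice H.
have q0 : 0 < (q%:R : R) by rewrite ltr0n ltnW.
have T0 : 0 < ((totient q)%:R : R) by rewrite ltr0n totient_gt0 ltnW.
pose L1 := \prod_(chi <- chs | chi \in chs) dirichletL 1 chi.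
pose lim := ((totient q)%:R / q%:R)%:C * L1.
have L1n0 : L1 != 0.
  rewrite /L1 prodf_seq_neq0; apply/allP => chi chich; apply/implyP => _.
  exact: (dirichletL_neq0 q_gt1 chs_uniq chsP chs_prod chich).
have cC : ((D (1 + d) * (1 - expR (- d)))%:C : (R[i])^o) @[d --> (0 : R)^'+] --> (lim : (R[i])^o).
  have c1 := cvg_real_complex _ (@zeta_residue R).
  have c2 := cvg_real_complex _ (@ramified_factor_cvg R q (ltnW q_gt1)).
  have c3 : (\prod_(chi <- chs | chi \in chs) dirichletL (1 + d) chi : (R[i])^o) @[d --> (0 : R)^'+] --> (L1 : (R[i])^o).
    apply: (@cvg_big ((R[i])^o) _ _ _ _ (@mul_continuous R[i])) => chi chich.
    by apply: dirichletL_at1 => //; move: chich; rewrite chsP => /asboolP[].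
  have c4 := cvgM (c1 _) (cvgM (c2 _) c3).
  have c5 : ((zeta (1 + d) * (1 - expR (- d)))%:C * ((ramified_factor q (1 + d))%:C *
     \prod_(chi <- chs | chi \in chs) dirichletL (1 + d) chi) : (R[i])^o) @[d --> (0 : R)^'+] --> (lim : (R[i])^o).
    by apply: cvg_to_eq; [exact: c4|rewrite mul1r].
  apply: cvg_trans c5; apply: near_eq_cvg; near=> d.
  have d0 : 0 < d by near: d; exact: nbhs_right_gt.
  have [//|_ DE _] := DP (1 + d); first by rewrite ltrDl.
  have -> : (D (1 + d) * (1 - expR (- d)))%:C = (D (1 + d))%:C * (1 - expR (- d))%:C.
    by rewrite rmorphM.
  by rewrite -DE -big_seq !rmorphM; ring.
have cR := cvg_Re _ cC.
pose l := complex.Re lim.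
(* A complex limit of real numbers is real. Its positivity combines the nonvanishing [L1n0] with the
   sign of [D]. *)
have limE : lim = l%:C.
  exact: (@cvg_unique _ (@norm_hausdorff _ ((R[i])^o : normedModType R[i])) _ _ _ _ cC (cvg_real_complex _ (cR _))).
have ln0 : l != 0.
  apply/eqP => h; move: limE; rewrite h /lim => /eqP; rewrite mulf_eq0 (negbTE L1n0) orbF.
  by rewrite fmorph_eq0 mulf_eq0 invr_eq0 !gt_eqF.
have l0 : 0 <= l.
  apply: (cvgr_to_ge (cR _)); near=> d.
  have d0 : 0 < d by near: d; exact: nbhs_right_gt.
  have [//|D1 _ _] := DP (1 + d); first by rewrite ltrDl.
  rewrite /= mulr_ge0// ?(le_trans _ D1)// subr_ge0 expR_le1 oppr_le0 ltW//.
exists D, l; split.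
- by rewrite lt_neqAle eq_sym ln0.
- rewrite /Pi_q1.
  have -> : [set chi : {ffun 'Z_q -> R[i]} | dirichlet_character chi /\ chi != principal_character R q]
     = [set` chs].
    by apply/seteqP; split => chi /=; rewrite chsP => /asboolP.
  rewrite -fsbig_seq// prodfV.
  have -> : \prod_(chi <- chs) dirichletL 1 chi = L1 by rewrite /L1 -big_seq.
  apply: (mulIf L1n0); rewrite mulVf//.
  have -> : L1 = ((totient q)%:R / q%:R)%:C^-1 * l%:C.
    by rewrite -limE /lim mulKf// fmorph_eq0 mulf_eq0 invr_eq0 !gt_eqF.
  rewrite -fmorphV -!rmorphM.
  rewrite (_ : _ * _ = 1)// ; field.
  by rewrite ln0 !gt_eqF.
- move=> s s1; have [D1 _ c] := DP s s1; split => //; exact: lt_le_trans D1.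
- exact: cR.
Unshelve. all: by end_near.
Qed.

(** * The Mertens product in the class of 1 *)

(** Dominated convergence for series, by cutting where the tail of the majorant is below e / 3; it
    lets s decrease to 1 inside the sum over primes. *)
Lemma tannery (R : realType) (T : Type) (F : set_system T) (FF : ProperFilter F)
    (f : T -> nat -> R) (f0 M : nat -> R) :
  (\forall t \near F, forall n, `|f t n| <= M n) -> (forall n, `|f0 n| <= M n) ->
  cvgn (series M) -> (forall n, f t n @[t --> F] --> f0 n) ->
  limn (series (f t)) @[t --> F] --> limn (series f0).
Proof.
move=> fM f0M cM ff0.
have M0 n : 0 <= M n by apply: le_trans (f0M n).
have cvgf (h : nat -> R) : (forall n, `|h n| <= M n) -> cvgn (series h).
  move=> hM; apply: normed_cvg; apply: (series_le_cvg _ M0 hM cM).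
  by move=> n; exact: normr_ge0.
have tail (h : nat -> R) N : (forall n, `|h n| <= M n) ->
    `|limn (series h) - series h N| <= limn (series M) - series M N.
  move=> hM.
  have c1 := cvg_norm (cvgB (cvgf h hM) (@cvg_cst _ (series h N) _ _ _)).
  have c2 := cvgB cM (@cvg_cst _ (series M N) _ _ _).
  apply: (ler_cvg_to (c1 _ _ _) (c2 _ _)); near=> K.
  have NK : (N <= K)%N by near: K; exact: nbhs_infty_ge.
  rewrite !fctE !sub_series_geq//; apply: le_trans (ler_norm_sum _ _ _) _.
  exact: ler_sum.
apply/cvgrPdist_le => e e0.
have e3 : 0 < e / 3 by rewrite divr_gt0.
have [N HN] : exists N, limn (series M) - series M N <= e / 3.
  move/cvgrPdist_le : cM => /(_ _ e3) [N _ HN]; exists N.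
  exact: le_trans (ler_norm _) (HN N (leqnn N)).
have cN : series (f t) N @[t --> F] --> series f0 N.
  by rewrite /series/=; apply: (cvg_big add_continuous) => i _; exact: ff0.
move/cvgrPdist_le : cN => /(_ _ e3) cN.
near=> t.
have h1 := tail f0 N f0M.
have ftM : forall n, `|f t n| <= M n by near: t.
have h2 := tail (f t) N ftM.
have h3 : `|series f0 N - series (f t) N| <= e / 3 by near: t.
move: h1 h2 h3; rewrite !ler_norml => /andP[? ?] /andP[? ?] /andP[? ?].
by apply/andP; split; lra.
Unshelve. all: by end_near.
Qed.

Lemma ln1B_ge (R : realType) (x : R) : x < 1 -> x <= - ln (1 - x).
Proof. by move=> x1; rewrite lerNr; apply: le_ln1Dx; rewrite ltrN2. Qed.

Lemma ln1B_le (R : realType) (x : R) : 0 <= x <= 2^-1 -> - ln (1 - x) <= x + 2 * x ^+ 2.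
Proof.
move=> /andP[x0 x2]; have x1 : 0 < 1 - x by lra.
rewrite -lnV ?posrE//.
have := @le_ln1Dx R ((1 - x)^-1 - 1); rewrite addrCA subrr addr0 => h.
apply: le_trans (h _) _; first by rewrite ltrBrDl subrr invr_gt0.
rewrite lerBlDr -[leLHS]mul1r ler_pdivrMr// expr2.
have : 0 <= x * (x * (1 - 2 * x)) by rewrite !mulr_ge0//; lra.
lra.
Qed.

Lemma powRN_nat_le_inv (R : realType) (p : nat) (s : R) : (1 < p)%N -> 1 <= s ->
  0 < (p%:R : R) `^ (- s) <= p%:R^-1.
Proof.
move=> p1 s1; rewrite powR_gt0 ?ltr0n 1?ltnW//= -powR_inv1//.
by rewrite ler_powR ?ler1n 1?ltnW// lerN2.
Qed.

Lemma inv_sqr_cvg (R : realType) : cvgn (series (fun n => (n%:R ^+ 2)^-1 : R)).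
Proof.
have c := @zeta_cvg R 2 (ltr1n _ 2).
apply/cvg_ex; exists (zeta 2); apply: cvg_trans c; apply: near_eq_cvg; near=> N.
have N0 : (0 < N)%N by near: N; exact: nbhs_infty_gt.
rewrite /series/= [RHS]big_ltn// expr0n invr0 add0r.
by apply: eq_bigr => i _; rewrite powR_invn.
Unshelve. all: by end_near.
Qed.

Lemma unit_order_eq1 q p : (1 < q)%N -> coprime q p ->
  (unit_order q p == 1%N) = (p == 1 %[mod q]).
Proof.
move=> q1 qp; have pu : (p%:R : 'Z_q) \is a GRing.unit by rewrite unitZpE.
rewrite /unit_order order_eq1 -/(zunit _) -(inj_eq val_inj) val_zunit//= -(inj_eq val_inj)/=.
by rewrite val_Zp_nat// Zp_cast.
Qed.

Lemma unit_order_dvd q p : (0 < q)%N -> (unit_order q p %| totient q)%N.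
Proof. by move=> q0; rewrite -card_units_Zp// order_dvdG// inE. Qed.

(** [prime_prod] is a [limn], so it can be used only after convergence is proved; the logarithms are
    dominated by a multiple of 1 / p^2. *)
Lemma prime_prod_cvg (R : realType) (P : pred nat) (F : nat -> R) (C : R) :
  (forall p, prime p -> P p -> 0 < F p) ->
  (forall p, prime p -> P p -> `|ln (F p)| <= C * (p%:R ^+ 2)^-1) ->
  (fun N => \prod_(0 <= p < N | prime p && P p) F p) @ \oo --> prime_prod P F.
Proof.
move=> F0 Fb.
pose h n := if prime n && P n then ln (F n) else 0.
have ch : cvgn (series h).
  have C0 n : 0 <= `|C| * (n%:R ^+ 2 : R)^-1 by rewrite mulr_ge0// invr_ge0 exprn_ge0.
  apply: normed_cvg; apply: (@series_le_cvg _ _ (fun n => `|C| * (n%:R ^+ 2)^-1)) => //.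
  - by move=> n; exact: normr_ge0.
  - move=> n; rewrite /h /=; case: ifPn => [/andP[pn Pn]|_]; last by rewrite normr0.
    by apply: le_trans (Fb _ pn Pn) _; rewrite ler_wpM2r ?invr_ge0 ?exprn_ge0// ler_norm.
  - by apply: is_cvg_seriesZ; exact: inv_sqr_cvg.
apply/cvg_ex; exists (expR (limn (series h))).
have c := cvg_comp _ _ ch (@continuous_expR R _).
apply: cvg_trans c; apply: near_eq_cvg; near=> N.
rewrite /= /series/= expR_sum [RHS]big_mkcond; apply: eq_bigr => i _.
rewrite /h; case: ifPn => [/andP[pi Pi]|_]; last by rewrite expR0.
by rewrite lnK// posrE F0.
Unshelve. all: by end_near.
Qed.

Section mertens_progression.
Variables (R : realType) (q : nat) (q_gt1 : (1 < q)%N).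

Let T := totient q.
Let T_gt0 : (0 < T)%N. Proof. by rewrite totient_gt0 ltnW. Qed.

Definition local_log (s : R) (p : nat) : R :=
  if prime p && coprime q p then - ln (local_factor q s p) else 0.

(** The part of [local_log] linear in p^(-s). A prime of order n starts with the power p^(-n s), so
    only order 1, that is p = 1 mod q, has such a part. *)
Definition first_order (s : R) (p : nat) : R :=
  if prime p && (p == 1 %[mod q]) then T%:R * p%:R `^ (- s) else 0.

Definition log_rem s p := local_log s p - first_order s p.

Lemma coprime_mod1 p : p == 1 %[mod q] -> coprime q p.
Proof. by move=> /eqP h; rewrite -coprime_modr h coprime_modr coprimen1. Qed.

Lemma local_logE s p : prime p -> coprime q p -> 0 < s ->
  local_log s p = (T %/ unit_order q p)%:R * - ln (1 - (p%:R `^ (- s)) ^+ unit_order q p).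
Proof.
move=> pp qp s0; rewrite /local_log pp qp /local_factor lnXn; last first.
  have := @subr1X_itv R (p%:R `^ (- s)) _ 1 (powRN_prime_lt1 pp s0) (unit_order_gt0 q p).
  by rewrite expr1 => /andP[].
by rewrite -mulNrn mulr_natl.
Qed.

(** With x = p^(-s) <= 1/p: for order 1 the remainder is T (- ln (1 - x) - x) <= 2 T x^2; for order
    n >= 2 one has - ln (1 - x^n) <= 2 x^n <= 2 x^2. The bound is uniform in s >= 1, as [tannery]
    requires. *)
Lemma log_rem_bound s p : 1 <= s -> 0 <= log_rem s p <= 2 * T%:R * (p%:R ^+ 2)^-1.
Proof.
move=> s1; have s0 : 0 < s by rewrite (lt_le_trans _ s1).
have z0 : 0 <= 2 * T%:R * (p%:R ^+ 2 : R)^-1 by rewrite mulr_ge0 ?invr_ge0 ?exprn_ge0.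
rewrite /log_rem; case: (boolP (prime p)) => [pp|/negbTE pp]; last first.
  by rewrite /local_log /first_order pp subrr lexx.
case: (boolP (coprime q p)) => [qp|qp]; last first.
  rewrite /local_log /first_order (negbTE qp) andbF ifF ?subrr ?lexx//.
  by rewrite pp/=; apply: contraNF qp; exact: coprime_mod1.
rewrite local_logE// /first_order pp/= -unit_order_eq1//.
have p1 := prime_gt1 pp.
have /andP[x0 xp] := powRN_nat_le_inv p1 s1.
set x := p%:R `^ (- s) in x0 xp *.
have p2 : (p%:R : R)^-1 <= 2^-1 by rewrite lef_pV2 ?posrE ?ltr0n ?(ltnW p1)// ler_nat.
have x2 : x ^+ 2 <= (p%:R ^+ 2)^-1.
  by rewrite -exprVn lerXn2r// ?nnegrE ?invr_ge0// ltW.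
have n0 := unit_order_gt0 q p; set n := unit_order q p in n0 *; clearbody n.
have T0 : 0 < (T%:R : R) by rewrite ltr0n.
case: eqVneq => [n1|n1].
  rewrite n1 divn1 expr1 -mulrBr.
  have h1 := @ln1B_ge R x; have h2 := @ln1B_le R x.
  have {}h1 : 0 <= - ln (1 - x) - x by rewrite subr_ge0 h1//; lra.
  have {}h2 : - ln (1 - x) - x <= 2 * (p%:R ^+ 2)^-1.
    by rewrite lerBlDl; apply: le_trans (h2 _) _; [rewrite (ltW x0)/=; lra|rewrite lerD2l ler_wpM2l].
  rewrite mulr_ge0 ?(ltW T0)//= [2 * _]mulrC -mulrA.
  by rewrite ler_wpM2l ?(ltW T0).
rewrite subr0.
have n2 : (2 <= n)%N by rewrite ltn_neqAle eq_sym n1.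
have xn : x ^+ n <= x ^+ 2.
  by rewrite ler_wiXn2l ?(ltW x0)// (le_trans (le_trans xp p2))// invf_le1// ler1n.
have xn0 : 0 < x ^+ n by rewrite exprn_gt0.
have xh : x <= 2^-1 := le_trans xp p2.
have x1 : x <= 1 by apply: le_trans xh _; rewrite invf_le1// ler1n.
have x2h : x ^+ 2 <= 2^-1.
  by apply: le_trans xh; rewrite -[leRHS]expr1 ler_wiXn2l// ltW.
have h1 : 0 <= - ln (1 - x ^+ n) by apply: le_trans (ltW xn0) (ln1B_ge _); lra.
have h2 : - ln (1 - x ^+ n) <= 2 * x ^+ n.
  apply: le_trans (ln1B_le _) _; first by rewrite (ltW xn0)/=; lra.
  have : 0 <= x ^+ n * (2^-1 - x ^+ n) by rewrite mulr_ge0 ?(ltW xn0)//; lra.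
  by rewrite expr2; lra.
rewrite mulr_ge0//= [2 * _]mulrC -mulrA ler_pM//; first by rewrite ler_nat leq_div.
by lra.
Qed.

Lemma log_rem_abs s p : 1 <= s -> `|log_rem s p| <= 2 * T%:R * (p%:R ^+ 2)^-1.
Proof. by move=> /(log_rem_bound p)/andP[h0 h1]; rewrite ger0_norm. Qed.

Lemma log_rem_cvg p : log_rem (1 + d) p @[d --> 0^'+] --> log_rem 1 p.
Proof.
rewrite /log_rem /local_log /first_order.
have cp (a b : bool) (f : R -> R) : (a && b -> f (1 + d) @[d --> (0 : R)^'+] --> f 1) ->
    (if a && b then f (1 + d) else 0) @[d --> (0 : R)^'+] --> (if a && b then f 1 else 0).
  by case: (a && b) => [|_]; [exact|exact: cvg_cst].
apply: cvgB.
  apply: (cp _ _ (fun s => - ln (local_factor q s p))) => /andP[pp qp].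
  have x := @cvg_powRN_1D R p (prime_gt0 pp).
  pose P : {poly R} := (1 - 'X^(unit_order q p)) ^+ (T %/ unit_order q p).
  have PE s : local_factor q s p = P.[p%:R `^ (- s)].
    by rewrite /P /local_factor !hornerE.
  have c1 := cvg_comp _ _ x (@continuous_horner R P _).
  have l0 : 0 < P.[(p%:R : R) `^ (- 1)].
    by rewrite -PE; have /andP[] := @local_factor_itv R q 1 p pp ltr01.
  have c2 := cvg_comp _ _ c1 (continuous_ln l0).
  under eq_fun do rewrite PE.
  by rewrite PE; apply: cvgN; exact: c2.
apply: (cp _ _ (fun s => T%:R * p%:R `^ (- s))) => /andP[pp _].
by apply: cvgMl_tmp; apply: cvg_powRN_1D; exact: prime_gt0.
Qed.

Let majorant_cvg : cvgn (series (fun p => 2 * T%:R * (p%:R ^+ 2)^-1 : R)).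
Proof. by apply: is_cvg_seriesZ; exact: inv_sqr_cvg. Qed.

Lemma log_rem_series_cvg s : 1 <= s -> cvgn (series (log_rem s)).
Proof.
move=> s1; apply: normed_cvg; apply: (series_le_cvg _ _ _ majorant_cvg).
- by move=> n; exact: normr_ge0.
- by move=> n; rewrite mulr_ge0 ?invr_ge0 ?exprn_ge0.
- by move=> n; exact: log_rem_abs.
Qed.

Lemma log_rem_series_at1 :
  limn (series (log_rem (1 + d))) @[d --> 0^'+] --> limn (series (log_rem 1)).
Proof.
apply: tannery majorant_cvg log_rem_cvg; last by move=> n; exact: log_rem_abs.
near=> d => n; apply: log_rem_abs; rewrite lerDl ltW//.
Unshelve. all: by end_near.
Qed.

Lemma local_log_series s N : 0 < s ->
  series (local_log s) N = - ln (\prod_(0 <= p < N | prime p && coprime q p) local_factor q s p).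
Proof.
move=> s0; rewrite /series/=; elim: N => [|N IH]; first by rewrite !big_geq// ln1 oppr0.
rewrite big_nat_recr//= IH [in RHS]big_mkcond big_nat_recr//= -big_mkcond /local_log.
case: ifPn => [/andP[pp qp]|_]; last by rewrite mulr1 addr0.
rewrite lnM ?opprD// posrE; last by have /andP[] := local_factor_itv q pp s0.
by apply: prodr_gt0 => p /andP[pp' _]; have /andP[] := local_factor_itv q pp' s0.
Qed.

Variables (D : R -> R) (l : R).
Hypothesis l_gt0 : 0 < l.
Hypothesis DP : forall s, 1 < s -> 0 < D s /\
  (fun N => \prod_(0 <= p < N | prime p && coprime q p) local_factor q s p) @ \oo --> (D s)^-1.
Hypothesis Dl : D (1 + d) * (1 - expR (- d)) @[d --> 0^'+] --> l.

Lemma first_order_series d : 0 < d ->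
  series (first_order (1 + d)) @ \oo --> ln (D (1 + d)) - limn (series (log_rem (1 + d))).
Proof.
move=> d0; have s1 : 1 < 1 + d by rewrite ltrDl.
have [D0 c] := DP s1.
have c1 : series (local_log (1 + d)) @ \oo --> ln (D (1 + d)).
  have DV : 0 < (D (1 + d))^-1 by rewrite invr_gt0.
  have c2 := cvgN (cvg_comp _ _ c (continuous_ln DV)).
  rewrite -[ln (D (1 + d))]opprK -lnV ?posrE//.
  apply: cvg_trans; last exact: c2.
  apply: near_eq_cvg; near=> N.
  by rewrite local_log_series// addr_gt0.
have c3 := cvgB c1 (log_rem_series_cvg (ltW s1)).
apply: cvg_trans; last exact: c3.
apply: near_eq_cvg; near=> N; rewrite fctE /series/= -sumrB.
by apply: eq_bigr => i _; rewrite /log_rem subKr.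
Unshelve. all: by end_near.
Qed.

Lemma first_order_laplace :
  laplace (first_order 1) (fun n => ln n%:R)
    (fun d => ln (D (1 + d)) - limn (series (log_rem (1 + d)))).
Proof.
move=> d d0; have := first_order_series d0.
apply: cvg_trans; apply: near_eq_cvg; near=> N; rewrite /series/=.
apply: eq_bigr => i _; rewrite /first_order; case: ifPn => [/andP[pi _]|_]; last by rewrite mul0r.
by rewrite !powR_natE ?prime_gt0// -mulrA -expRD; congr (_ * expR _); ring.
Unshelve. all: by end_near.
Qed.

Lemma first_order_mass :
  mass_upto (first_order 1) (fun n => ln n%:R)
    (fun t => series (first_order 1) (Num.truncn (expR t)).+1).
Proof.
move=> t; apply: mass_upto_cut => -[|n]; first by rewrite /first_order eqxx.
move=> _; rewrite ltnS truncn_ge_nat ?expR_ge0// -{1}[t]expRK ler_ln ?posrE ?expR_gt0//.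
Qed.

Lemma first_order_asymp :
  series (first_order 1) (Num.truncn x).+1 - ln (ln x) @[x --> +oo] -->
    ln l - limn (series (log_rem 1)) + euler_gamma R.
Proof.
(* The comparison takes place in the variable t = ln x, because the masses sit at ln p. *)
have c : series (first_order 1) (Num.truncn (expR t)).+1 - ln t @[t --> +oo] -->
    ln l - limn (series (log_rem 1)) + euler_gamma R.
  apply: (karamata_compare _ _ _ _ first_order_laplace (@harmonic_laplace R)
    first_order_mass (@harmonic_mass R) (@harmonic_laplace_gap R) _ (@harmonic_mass_asymp R)).
  - by move=> n; rewrite /first_order; case: ifP => // _; rewrite mulr_ge0 ?powR_ge0.
  - by move=> [|n]; [rewrite ln0|rewrite ln_ge0 ?ler1n].
  - by move=> n; rewrite invr_ge0.
  - by move=> n.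
  have c1 := cvg_comp _ _ Dl (continuous_ln l_gt0).
  have c2 := cvgB c1 log_rem_series_at1.
  apply: cvg_trans; last exact: c2.
  apply: near_eq_cvg; near=> d; rewrite fctE /=.
  have d0 : 0 < d by near: d; exact: nbhs_right_gt.
  have [//|D0 _] := DP (s := 1 + d); first by rewrite ltrDl.
  rewrite lnM ?posrE// ?subr_gt0 ?expR_lt1 ?oppr_lt0// !fctE; ring.
have lny : ln x @[x --> (+oo : set_system R)] --> +oo.
  apply/cvgryPge => A; apply: filterS (nbhs_pinfty_ge (num_real (expR A))) => x Ax.
  by rewrite -[A]expRK ler_ln ?posrE ?expR_gt0// (lt_le_trans _ Ax)// expR_gt0.
have c1 := cvg_comp _ _ lny c.
apply: cvg_trans c1; apply: near_eq_cvg; near=> x => /=.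
by rewrite lnK// posrE; near: x; exact: nbhs_pinfty_gt.
Unshelve. all: by end_near.
Qed.

End mertens_progression.

Lemma ln1B_abs (R : realType) (y : R) : 0 <= y <= 2^-1 -> `|ln (1 - y)| <= 2 * y.
Proof.
move=> /andP[y0 y2]; rewrite -normrN ger0_norm; last by apply: le_trans y0 (ln1B_ge _); lra.
apply: le_trans (ln1B_le _) _; first by rewrite y0.
have : 0 <= y * (2^-1 - y) by rewrite mulr_ge0// subr_ge0.
by rewrite expr2; lra.
Qed.

Lemma inv_exp_itv (R : realType) (p n : nat) : (1 < p)%N -> (1 < n)%N ->
  [/\ 0 < (p%:R ^+ n : R)^-1, (p%:R ^+ n : R)^-1 <= (p%:R ^+ 2)^-1 &
      (p%:R ^+ n : R)^-1 <= 2^-1].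
Proof.
move=> p1 n1; have p0 : 0 < (p%:R : R) by rewrite ltr0n ltnW.
have h : (p%:R ^+ n : R)^-1 <= (p%:R ^+ 2)^-1.
  by rewrite lef_pV2 ?posrE ?exprn_gt0// ler_weXn2l// ler1n ltnW.
split => //; first by rewrite invr_gt0 exprn_gt0.
apply: le_trans h _; rewrite lef_pV2 ?posrE ?exprn_gt0//.
by rewrite -natrX ler_nat (leq_trans p1)// -{1}[p]expn1 leq_pexp2l// ltnW.
Qed.

(** 1 and -1 are distinct units. This puts zeta(phi(q)) in the range where its series converges. *)
Lemma totient_gt1 q : (3 <= q)%N -> (1 < totient q)%N.
Proof.
move=> q3; have q1 : (1 < q)%N by apply: ltnW.
rewrite -card_units_Zp ?(ltnW q1)//.
have u1 : (-1 : 'Z_q) \is a GRing.unit by rewrite unitrN1.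
have : (#|[set (1%g : {unit 'Z_q}); zunit ((-1)%R : 'Z_q)]%SET| <= #|units_Zp q|)%N.
  by by rewrite [leqRHS]cardsT; exact: max_card.
apply: leq_trans; rewrite cards2 -(inj_eq val_inj) val_zunit//=.
case: eqP => // h.
have : (2%:R : 'Z_q) = 0 by rewrite mulr2n {1}h addNr.
by move/(congr1 (@nat_of_ord _)); rewrite val_Zp_nat//= modn_small.
Qed.

(** * The value of the Mertens constant *)

Section mertens_product.
Variables (R : realType) (q : nat) (q_gt1 : (1 < q)%N).
Let T := totient q.
Let T_gt0 : 0 < (T%:R : R). Proof. by rewrite ltr0n totient_gt0 ltnW. Qed.

(** The correction from phi(q) / p to - phi(q) ln (1 - 1/p) at the primes p = 1 mod q, which are
    those that split completely in the q-th cyclotomic field. *)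
Definition split_rem (p : nat) : R :=
  if p == 1 %[mod q] then log_rem q 1 p else 0.

Lemma split_rem_cvg : cvgn (series split_rem).
Proof.
apply: normed_cvg; apply: (@series_le_cvg _ _ (fun p => 2 * T%:R * (p%:R ^+ 2)^-1)).
- by move=> n; exact: normr_ge0.
- by move=> n; rewrite mulr_ge0 ?invr_ge0 ?exprn_ge0// mulr_ge0.
- move=> n /=; rewrite /split_rem; case: ifP => _; first exact: log_rem_abs.
  by rewrite normr0 mulr_ge0 ?invr_ge0 ?exprn_ge0// mulr_ge0.
- by apply: is_cvg_seriesZ; exact: inv_sqr_cvg.
Qed.

Lemma progression_log (p : nat) : prime p -> p == 1 %[mod q] ->
  first_order q 1 p + split_rem p = T%:R * - ln (1 - p%:R^-1).
Proof.
move=> pp p1; have qp := coprime_mod1 p1.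
rewrite /split_rem p1 /log_rem addrC subrK local_logE//.
have /eqP -> : unit_order q p == 1%N by rewrite unit_order_eq1.
by rewrite divn1 expr1 powR_inv1.
Qed.

Let inv_prime_lt1 (p : nat) : prime p -> 0 < 1 - (p%:R : R)^-1.
Proof. by move=> pp; rewrite subr_gt0 invf_lt1 ?ltr1n ?ltr0n ?prime_gt0 ?prime_gt1. Qed.

Lemma progression_product N :
  \prod_(0 <= p < N | prime p && (p == 1 %[mod q])) (1 - (p%:R : R)^-1) =
  expR (T%:R^-1 * - (series (first_order q 1) N + series split_rem N)).
Proof.
rewrite /series/= -big_split/= mulrN mulr_sumr -sumrN expR_sum big_mkcond.
apply: eq_bigr => p _; case: ifPn => [/andP[pp p1]|].
  by rewrite progression_log// mulrA mulVf ?gt_eqF// mul1r opprK lnK// posrE inv_prime_lt1.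
move=> h; rewrite /first_order (negbTE h) add0r /split_rem.
case: ifP => p1; last by rewrite mulr0 oppr0 expR0.
have pp : prime p = false by apply: contraNF h => ->.
by rewrite /log_rem /local_log /first_order pp subrr mulr0 oppr0 expR0.
Qed.

Variables (D : R -> R) (l : R).
Hypothesis l_gt0 : 0 < l.
Hypothesis DP : forall s, 1 < s -> 0 < D s /\
  (fun N => \prod_(0 <= p < N | prime p && coprime q p) local_factor q s p) @ \oo --> (D s)^-1.
Hypothesis Dl : D (1 + d) * (1 - expR (- d)) @[d --> 0^'+] --> l.

(** This is phi(q) ln C(q,1). *)
Let kappa := - (ln l - limn (series (log_rem q 1)) + euler_gamma R) - limn (series split_rem).

Lemma mertens_constE : mertens_const R q 1 = expR (T%:R^-1 * kappa).
Proof.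
apply: (@cvg_lim R); first exact: norm_hausdorff.
have c1 := first_order_asymp q_gt1 l_gt0 DP Dl.
have tr : (Num.truncn (x : R)).+1 @[x --> +oo] --> \oo.
  move=> A [N _ NA]; exists N%:R; split; first exact: num_real.
  move=> x Nx; apply: NA => /=; rewrite ltnW// ltnS truncn_ge_nat ?ltW//.
  exact: le_lt_trans Nx.
have c2 := cvg_comp _ _ tr split_rem_cvg.
have c3 := cvgB (cvgN c1) c2.
have c4 := @cvgMl_tmp _ _ _ _ _ (T%:R^-1) _ (c3 _ _).
have c5 := cvg_comp _ _ (c4 _ _ _) (@continuous_expR R _).
apply: cvg_trans; last exact: c5.
apply: near_eq_cvg; near=> x.
have x1 : 1 < x by near: x; apply: nbhs_pinfty_gt; exact: num_real.
have lx : 0 < ln x by rewrite ln_gt0.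
rewrite /= !fctE /= progression_product /powR gt_eqF// -expRD; congr expR.
ring.
Unshelve. all: by end_near.
Qed.

(** The exp(-gamma) coming from [kappa] cancels the one in the definition of c(q,1), and phi(q) / q
    / l is Pi(q,1). The last exponential collects the primes of order greater than 1. *)
Lemma mertens_cE : mertens_c R q 1 =
  T%:R / q%:R / l * expR (limn (series (log_rem q 1)) - limn (series split_rem)).
Proof.
rewrite /mertens_c mertens_constE -expRM_natl mulrA divff ?gt_eqF// mul1r.
set w := limn (series (log_rem q 1)) - _.
have -> : kappa = - euler_gamma R + (- ln l + w) by rewrite /kappa /w; ring.
have e : expR (- ln l + w) = l^-1 * expR w by rewrite expRD expRN lnK ?posrE.
rewrite expRD e.
set G := expR (- _); have G0 : G != 0 by rewrite gt_eqF ?expR_gt0.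
have q0 : (q%:R : R) != 0 by rewrite pnatr_eq0 -lt0n ltnW.
by field; rewrite q0 G0 !gt_eqF.
Qed.

(** At p = 1 mod q the two remainders cancel. At every other prime not dividing q [first_order] is
    0, so [log_rem] is the whole logarithm of the local factor. *)
Lemma nonsplit_product :
  (fun N => \prod_(0 <= p < N | prime p && (coprime q p && (unit_order q p != 1%N)))
     ((1 - (p%:R ^+ unit_order q p : R)^-1) ^- (T %/ unit_order q p))) @ \oo -->
  expR (limn (series (log_rem q 1)) - limn (series split_rem)).
Proof.
have c1 := log_rem_series_cvg q_gt1 (lexx (1 : R)).
have c2 := cvgB c1 split_rem_cvg.
have c3 := cvg_comp _ _ (c2 _) (@continuous_expR R _).
apply: cvg_trans; last exact: c3.
apply: near_eq_cvg; near=> N.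
rewrite /= !fctE /series/= -sumrB expR_sum [RHS]big_mkcond; apply: eq_bigr => p _.
rewrite /split_rem.
case: (boolP (prime p)) => [pp|/negbTE pp]; last first.
  by rewrite /log_rem /local_log /first_order pp/=; case: ifP => _; rewrite ?subrr ?subr0 expR0.
case: (boolP (coprime q p)) => [qp|qp]; last first.
  have p1 : (p == 1 %[mod q]) = false by apply: contraNF qp; exact: coprime_mod1.
  by rewrite p1 /log_rem /local_log /first_order (negbTE qp) p1 !andbF !subr0 expR0.
rewrite unit_order_eq1//=; case: ifP => p1 /=; first by rewrite subrr expR0.
rewrite subr0 /log_rem /local_log /first_order pp qp p1 /= subr0 expRN.
have /andP[f0 _] := @local_factor_itv R q 1 p pp ltr01.
by rewrite lnK ?posrE// /local_factor powR_inv1// exprVn.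
Unshelve. all: by end_near.
Qed.

End mertens_product.

(** * Rearranging the elementary products *)

Section ordinary_part.
Variables (R : realType) (q : nat) (q_ge3 : (3 <= q)%N).
Let T := totient q.
Let q_gt1 : (1 < q)%N. Proof. exact: ltnW. Qed.
Let T_gt1 : (1 < T)%N. Proof. exact: totient_gt1. Qed.

Let zT (p : nat) : R := 1 - (p%:R ^+ T)^-1.
Let zT_gt0 p : (1 < p)%N -> 0 < zT p.
Proof. by move=> p1; have [h0 _ h1] := @inv_exp_itv R p T p1 T_gt1; rewrite /zT; lra. Qed.
Let zT_ln p : (1 < p)%N -> `|ln (zT p)| <= 2 * (p%:R ^+ 2)^-1.
Proof.
move=> p1; have [h0 h2 h1] := @inv_exp_itv R p T p1 T_gt1.
by apply: le_trans (ln1B_abs _) _; [rewrite (ltW h0)|rewrite ler_wpM2l].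
Qed.

Lemma split_prime_prod_cvg :
  (fun N => \prod_(0 <= p < N | prime p && (p == 1 %[mod q])) zT p) @ \oo -->
    prime_prod (fun p => p == 1 %[mod q]) zT.
Proof.
apply: (@prime_prod_cvg _ _ _ 2) => p pp _; first exact/zT_gt0/prime_gt1.
exact/zT_ln/prime_gt1.
Qed.

Let order_class n p := ~~ (p %| q)%N && (unit_order q p == n).
Let order_term n p : R := (1 - (p%:R ^+ n)^-1) ^- (T %/ n) * zT p.

Lemma order_prime_prod_cvg n : (1 < n)%N ->
  (fun N => \prod_(0 <= p < N | prime p && order_class n p) order_term n p) @ \oo -->
    prime_prod (order_class n) (order_term n).
Proof.
move=> n1; apply: (@prime_prod_cvg _ _ _ (2 * T%:R + 2)) => p pp _; have p1 := prime_gt1 pp;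
  have [h0 h2 h1] := @inv_exp_itv R p n p1 n1;
  have y0 : 0 < 1 - (p%:R ^+ n : R)^-1 by lra.
  by rewrite /order_term mulr_gt0 ?zT_gt0// invr_gt0 exprn_gt0.
rewrite /order_term lnM ?posrE ?zT_gt0 ?invr_gt0 ?exprn_gt0// lnV ?posrE ?exprn_gt0// lnXn//.
apply: le_trans (ler_normD _ _) _; rewrite mulrDl lerD ?zT_ln//.
rewrite normrN normrMn -[leLHS]mulr_natl [2 * T%:R]mulrC -[leRHS]mulrA.
rewrite ler_pM// ?ler_nat ?leq_div//.
by apply: le_trans (ln1B_abs _) _; [rewrite (ltW h0)|rewrite ler_wpM2l].
Qed.

(** A prime-by-prime identity. If p divides q, or has order 1, or has order strictly between 1 and
    T, exactly one product on the left supplies the factor [zT p]. If p has order T, the left side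
    contributes nothing, and on the right [zT p] meets its inverse. The bound on N brings all prime
    divisors of q into range. *)
Lemma zeta_totient_partial N : (q < N)%N ->
  \prod_(p <- primes q) zT p *
  \prod_(0 <= p < N | prime p && (p == 1 %[mod q])) zT p *
  \prod_(n <- divisors T | (1 < n < T)%N)
     \prod_(0 <= p < N | prime p && order_class n p) order_term n p =
  \prod_(0 <= p < N | prime p) zT p *
  \prod_(0 <= p < N | prime p && (coprime q p && (unit_order q p != 1%N)))
     ((1 - (p%:R ^+ unit_order q p : R)^-1) ^- (T %/ unit_order q p)).
Proof.
move=> qN; have q0 : (0 < q)%N by exact: ltnW.
have -> : \prod_(p <- primes q) zT p = \prod_(0 <= p < N | prime p && ~~ coprime q p) zT p.
  have := @ramified_factorE R q T%:R N q0 qN; rewrite /ramified_factor => h.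
  transitivity (\prod_(p <- primes q) (1 - (p%:R : R) `^ (- T%:R))).
    by apply: eq_bigr => p _; rewrite /zT powR_invn.
  by rewrite -h; apply: eq_bigr => p _; rewrite /zT powR_invn.
have -> : \prod_(n <- divisors T | (1 < n < T)%N)
     \prod_(0 <= p < N | prime p && order_class n p) order_term n p =
   \prod_(0 <= p < N | prime p) \prod_(n <- divisors T | (1 < n < T)%N && order_class n p)
     order_term n p.
  under eq_bigr do rewrite big_mkcondr.
  by rewrite exchange_big/=; apply: eq_bigr => p _; rewrite [RHS]big_mkcondr.
rewrite !big_mkcondr -!big_split/=; apply: eq_bigr => p pp.
have p1 := prime_gt1 pp; have zn0 : zT p != 0 by rewrite gt_eqF// zT_gt0.
have cop : ~~ (p %| q)%N = coprime q p by rewrite coprime_sym prime_coprime.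
case: (boolP (coprime q p)) => qp /=; last first.
  have p1' : (p == 1 %[mod q]) = false by apply: contraNF qp; exact: coprime_mod1.
  by rewrite p1' big_pred0 ?mulr1// => n; rewrite /order_class cop (negbTE qp) andbF.
rewrite -unit_order_eq1// mul1r.
set m := unit_order q p.
have m0 : (0 < m)%N := unit_order_gt0 q p.
have mT : (m %| T)%N by apply: unit_order_dvd; exact: ltnW.
have -> : \prod_(n <- divisors T | (1 < n < T)%N && order_class n p) order_term n p =
    if (1 < m < T)%N then order_term m p else 1.
  rewrite (eq_bigl (fun n => (1 < m < T)%N && (n == m))); last first.
    move=> n; rewrite /order_class cop qp /= -/m eq_sym.
    by case: eqVneq => [->|]; rewrite ?andbT ?andbF.
  case: ifP => h /=; last by rewrite big_pred0.
  rewrite -big_filter filter_pred1_uniq ?divisors_uniq// -?dvdn_divisors ?(ltnW T_gt1)//.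
  by rewrite big_seq1.
case: (eqVneq m 1%N) => m1 /=; first by rewrite m1 /= mulr1.
rewrite mul1r.
have m2 : (1 < m)%N by rewrite ltn_neqAle eq_sym m1.
rewrite m2 /=; case: (ltngtP m T) => [mT'|mT'|mT'].
- by rewrite /order_term mulrC.
- by move: mT'; rewrite ltnNge dvdn_leq// ltnW.
- by rewrite mT' divnn ltnW// expr1 -/(zT p) divff.
Qed.

End ordinary_part.

(** Multiplied by zeta(phi(q)), the right-hand side of [zeta_totient_partial] loses its full Euler
    product in the limit, and only the product over the primes of order greater than 1 survives. *)
Lemma zeta_totient_product (R : realType) (q : nat) : (3 <= q)%N ->
  (zeta ((totient q)%:R : R))
    * (\prod_(p <- primes q) (1 - (p%:R ^+ totient q)^-1 : R))
    * (prime_prod (fun p => p == 1 %[mod q])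
         (fun p => 1 - (p%:R ^+ totient q)^-1 : R))
    * (\prod_(n <- divisors (totient q) | (1 < n < totient q)%N)
         prime_prod (fun p => ~~ (p %| q)%N && (unit_order q p == n))
           (fun p => (1 - (p%:R ^+ n)^-1) ^- (totient q %/ n)
                     * (1 - (p%:R ^+ totient q)^-1) : R)) =
  expR (limn (series (@log_rem R q 1)) - limn (series (@split_rem R q))).
Proof.
move=> q3; have q1 : (1 < q)%N by apply: ltnW.
set ram := \prod_(p <- primes q) _.
have T1 : (1 : R) < (totient q)%:R by rewrite ltr1n totient_gt1.
have c1 := @split_prime_prod_cvg R q q3.
have c2 : (fun N => \prod_(n <- divisors (totient q) | (1 < n < totient q)%N)
     \prod_(0 <= p < N | prime p && (~~ (p %| q)%N && (unit_order q p == n)))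
       ((1 - (p%:R ^+ n)^-1) ^- (totient q %/ n) * (1 - (p%:R ^+ totient q)^-1) : R)) @ \oo -->
   \prod_(n <- divisors (totient q) | (1 < n < totient q)%N)
         prime_prod (fun p => ~~ (p %| q)%N && (unit_order q p == n))
           (fun p => (1 - (p%:R ^+ n)^-1) ^- (totient q %/ n)
                     * (1 - (p%:R ^+ totient q)^-1) : R).
  apply: (cvg_big (@mul_continuous R)) => n /andP[n1 _].
  exact: order_prime_prod_cvg.
have c3 := cvgM (@cvgMl_tmp R _ _ _ _ (zeta (totient q)%:R * ram) _ c1) c2.
have c4 := cvgM (zeta_euler T1) (@nonsplit_product R q q1).
rewrite mul1r in c4.
suff c5 : (fun N => zeta (totient q)%:R * ram *
    \prod_(0 <= p < N | prime p && (p == 1 %[mod q])) (1 - (p%:R ^+ totient q)^-1) *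
    \prod_(n <- divisors (totient q) | (1 < n < totient q)%N)
     \prod_(0 <= p < N | prime p && (~~ (p %| q)%N && (unit_order q p == n)))
       ((1 - (p%:R ^+ n)^-1) ^- (totient q %/ n) * (1 - (p%:R ^+ totient q)^-1) : R)) @ \oo -->
    expR (limn (series (@log_rem R q 1)) - limn (series (@split_rem R q))).
  exact: (@cvg_unique R (@norm_hausdorff _ R) _ _ _ _ (c3 _ _) c5).
apply: cvg_trans; last exact: c4.
apply: near_eq_cvg; near=> N.
have qN : (q < N)%N by near: N; exact: nbhs_infty_gt.
have pE : \prod_(0 <= p < N | prime p) (1 - (p%:R : R) `^ (- (totient q)%:R)) =
    \prod_(0 <= p < N | prime p) (1 - (p%:R ^+ totient q)^-1).
  by apply: eq_bigr => p _; rewrite powR_invn.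
by rewrite /= -[LHS]mulrA pE -(@zeta_totient_partial R q q3 N qN) -!mulrA.
Unshelve. all: by end_near.
Qed.

Theorem mainTheorem2 (R : realType) (q : nat)
    (q_ge3 : (3 <= q)%N) (q_cyc : cyclic (units_Zp q)) :
  (mertens_c R q 1)%:C =
    (zeta ((totient q)%:R : R))%:C
    * Pi_q1 R q
    * (\prod_(p <- primes q) (1 - (p%:R ^+ totient q)^-1 : R))%:C
    * (prime_prod (fun p => p == 1 %[mod q])
         (fun p => 1 - (p%:R ^+ totient q)^-1 : R))%:C
    * (\prod_(n <- divisors (totient q) | (1 < n < totient q)%N)
         prime_prod (fun p => ~~ (p %| q)%N && (unit_order q p == n))
           (fun p => (1 - (p%:R ^+ n)^-1) ^- (totient q %/ n)
                     * (1 - (p%:R ^+ totient q)^-1) : R))%:C.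
Proof.
have q1 : (1 < q)%N by apply: ltnW.
have [D [l [l0 PiE DP Dl]]] := product_of_L_limit R q1 q_cyc.
rewrite (mertens_cE q1 l0 DP Dl) -(zeta_totient_product R q_ge3) PiE -!rmorphM.
by congr (_%:C); ring.
Qed.
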